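(* Let $0\le \ell_1,\ell_2<1$ with $\ell_1+\ell_2>0$. For initial data $\phi^0\in H_0^1(I_{t_0})$, $\phi^1\in L^2(I_{t_0})$, let $\phi$ denote the solution of (WP) and $E$ its energy. (1) For every $T\ge0$ there is a constant $\tilde K_\ell(T)$, depending only on $\ell_1,\ell_2$ and $T$, such that every solution of (WP) with initial data $\phi^0\in H_0^1(I_{t_0})$, $\phi^1\in L^2(I_{t_0})$ satisfies the direct inequality $$\int_{t_0}^{t_0+T}\left(\phi_x^2(-\ell_1t,t)+\phi_x^2(\ell_2t,t)\right)dt\le\tilde K_\ell(T)\,E(t_0).$$ (2) If $T\ge\tilde T_\ell$, then (WP) is observable at the two endpoints $x=-\ell_1t$, $x=\ell_2t$, and every solution of (WP) with initial data $\phi^0\in H_0^1(I_{t_0})$, $\phi^1\in L^2(I_{t_0})$ satisfies $$E(t_0)\le\frac{(1-l^2)^2\max\{\alpha_\ell,\beta_\ell\}}{4(1-L)}\int_{t_0}^{t_0+T}\left(\phi_x^2(-\ell_1t,t)+\phi_x^2(\ell_2t,t)\right)dt.\qquad( * )$$ Conversely, if $0\le T<\tilde T_\ell$, the inequality $( * )$ does not hold (i.e. it fails for some solution of (WP) with initial data $\phi^0\in H_0^1(I_{t_0})$, $\phi^1\in L^2(I_{t_0})$).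
   Context: Let $L_0>0$, $t_0=L_0/(\ell_1+\ell_2)$, and $I_t=(-\ell_1t,\ell_2t)$ for $t\ge t_0$. All initial data and solutions are real-valued. Problem (WP) is the wave equation $$\phi_{tt}-\phi_{xx}=0 \text{ for } x\in I_t,\ t>t_0,\qquad \phi(-\ell_1t,t)=\phi(\ell_2t,t)=0 \text{ for } t>t_0,\qquad \phi(\cdot,t_0)=\phi^0,\ \phi_t(\cdot,t_0)=\phi^1 \text{ in } I_{t_0}.$$ For $\phi^0\in H^1_0(I_{t_0})$, $\phi^1\in L^2(I_{t_0})$ it has a unique solution with $\phi(\cdot,t)\in H_0^1(I_t)$, $\phi_t(\cdot,t)\in L^2(I_t)$ depending continuously on $t\ge t_0$. Its energy is $E(t)=\frac12\int_{-\ell_1t}^{\ell_2t}\left(\phi_x^2(x,t)+\phi_t^2(x,t)\right)dx$. The functions $t\mapsto\phi_x(-\ell_1t,t)$ and $t\mapsto\phi_x(\ell_2t,t)$ are the boundary traces of $\phi_x$ (defined for general data by continuous extension from smooth solutions). (WP) is called observable at both endpoints in time $T$ if there is a constant $C>0$ such that $E(t_0)\le C\int_{t_0}^{t_0+T}\left(\phi_x^2(-\ell_1t,t)+\phi_x^2(\ell_2t,t)\right)dt$ for all solutions of (WP). Constants: $l=\min\{\ell_1,\ell_2\}$, $L=\max\{\ell_1,\ell_2\}$, $\alpha_\ell=\frac{1+\ell_1}{1-\ell_2}$, $\beta_\ell=\frac{1+\ell_2}{1-\ell_1}$, and $$\tilde T_\ell=\max\left\{\frac{L_0}{1-\ell_1},\frac{L_0}{1-\ell_2}\right\}=\left(\max\{\alpha_\ell,\beta_\ell\}-1\right)t_0.$$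 *)

(* Defs.v *)
From HB Require Import structures.
From mathcomp Require Import all_boot all_order all_algebra.
From mathcomp Require Import all_classical all_reals all_analysis.

Set Implicit Arguments.
Unset Strict Implicit.
Unset Printing Implicit Defensive.

Import Order.TTheory GRing.Theory Num.Theory.
Import numFieldNormedType.Exports.

Local Open Scope classical_set_scope.
Local Open Scope ring_scope.

(* A function of (x, t) is a function on R * R; the pair is (x, t).
   As usual for L^2 objects, functions stand for their classes modulo
   equality almost everywhere. *)

Section FunctionSpaces.
Context {R : realType}.
Local Notation mu := (@lebesgue_measure R).

Definition slice (f : R * R -> R) (t : R) : R -> R := fun x => f (x, t).

(* f \_ D is f extended by 0 outside D. *)
Definition L2 (D : set R) (f : R -> R) : Prop := f \_ D \in Lfun mu 2%:E.

Definition L2_dist (f g : R -> R) : \bar R :=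
  Lnorm mu 2%:E (EFin \o (fun x => f x - g x)).

Definition L2_cvg (D : set R) (u : nat -> R -> R) (f : R -> R) : Prop :=
  [/\ forall n, L2 D (u n), L2 D f &
      L2_dist (u n \_ D) (f \_ D) @[n --> \oo] --> 0%E].

Definition compact_support_in (T : topologicalType) (D : set T) (f : T -> R) :=
  exists K : set T, [/\ compact K, K `<=` D & forall z, ~ K z -> f z = 0].

Definition C1c (D : set R) (v : R -> R) : Prop :=
  [/\ forall x, derivable v x 1, continuous (derive1 v) & compact_support_in D v].

(* g is the weak derivative of u on the open set D *)
Definition weak_derivative (D : set R) (u g : R -> R) : Prop :=
  forall v, C1c D v ->
    \int[mu]_(x in D) (u x * derive1 v x) = - \int[mu]_(x in D) (g x * v x).

(* u is in H^1_0(D), with weak derivative g, where H^1_0(D) is the closure of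
   C^1_c(D) in H^1(D). *)
Definition H10_with (D : set R) (u g : R -> R) : Prop :=
  [/\ L2 D u, L2 D g, weak_derivative D u g &
      exists v : nat -> R -> R,
        [/\ forall n, C1c D (v n), L2_cvg D v u &
            L2_cvg D (fun n => derive1 (v n)) g]].

Definition H10 (D : set R) (u : R -> R) : Prop := exists g, H10_with D u g.

Definition dx (u : R * R -> R) : R * R -> R := 'D_((1, 0) : R * R) u.
Definition dt (u : R * R -> R) : R * R -> R := 'D_((0, 1) : R * R) u.

Definition C1_on (O : set (R * R)) (u : R * R -> R) : Prop :=
  forall z, O z ->
    [/\ derivable u z ((1, 0) : R * R), derivable u z ((0, 1) : R * R),
        {for z, continuous (dx u)} & {for z, continuous (dt u)}].

Definition C2_on (O : set (R * R)) (u : R * R -> R) : Prop :=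
  [/\ C1_on O u, C1_on O (dx u) & C1_on O (dt u)].

Definition C1c2 (D : set (R * R)) (psi : R * R -> R) : Prop :=
  C1_on setT psi /\ compact_support_in D psi.

End FunctionSpaces.

Section WaveProblem.
Context {R : realType}.
Variables l1 l2 L0 : R.
Local Notation mu := (@lebesgue_measure R).

Definition start : R := L0 / (l1 + l2).

Definition I_ (t : R) : set R := `](- (l1 * t)), (l2 * t)[.

Definition Q : set (R * R) := [set z | start < z.2 /\ I_ z.2 z.1].

Definition Qbar : set (R * R) :=
  [set z | start <= z.2 /\ - (l1 * z.2) <= z.1 <= l2 * z.2].

(* The curve t |-> f(., t), defined for t >= start, is continuous for the L^2
   norm. Slices on different intervals are compared after extension by 0. *)
Definition L2_continuous (f : R * R -> R) : Prop :=
  forall t, start <= t ->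
    L2_dist (slice f s \_ (I_ s)) (slice f t \_ (I_ t))
      @[s --> within [set s | start <= s] (nbhs t)] --> 0%E.

Definition integralQ (f : R * R -> R) : R :=
  \int[mu]_(t in `]start, +oo[) \int[mu]_(x in I_ t) f (x, t).

(* phi is the solution with data phi0, phi1, and phix, phit are its weak
   derivatives. The boundary conditions are contained in phi(., t) being in
   H^1_0; the equation holds in the sense of distributions. *)
Record wave_solution (phi0 phi1 : R -> R) (phi phix phit : R * R -> R) : Prop :=
  WaveSolution {
    wave_H10 : forall t, start <= t ->
      H10_with (I_ t) (slice phi t) (slice phix t) ;
    wave_L2 : forall t, start <= t -> L2 (I_ t) (slice phit t) ;
    wave_continuous : L2_continuous phi ;
    wave_continuous_x : L2_continuous phix ;
    wave_continuous_t : L2_continuous phit ;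
    wave_dt : forall psi, C1c2 Q psi ->
      integralQ (fun z => phi z * dt psi z) =
      - integralQ (fun z => phit z * psi z) ;
    wave_eq : forall psi, C1c2 Q psi ->
      integralQ (fun z => phit z * dt psi z - phix z * dx psi z) = 0 ;
    wave_init0 :
      {ae mu, forall x, I_ start x -> phi (x, start) = phi0 x} ;
    wave_init1 :
      {ae mu, forall x, I_ start x -> phit (x, start) = phi1 x}
  }.

(* Classical solutions, C^2 up to the boundary: C^2 on an open neighbourhood of
   the closure of Q, so that dx u makes sense on the lateral boundary. *)
Definition smooth_solution (u : R * R -> R) : Prop :=
  [/\ exists O : set (R * R), [/\ open O, Qbar `<=` O & C2_on O u],
      forall z, Q z -> dt (dt u) z - dx (dx u) z = 0 &
      forall t, start < t -> u (- (l1 * t), t) = 0 /\ u (l2 * t, t) = 0].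

(* tl and tr are the traces of phi_x at x = - l1 t and x = l2 t: the limits, in
   L^2 of every bounded time interval, of the traces of smooth solutions whose
   data converge to those of phi in H^1 x L^2 (the closure of the graph of the
   trace map on smooth solutions). *)
Definition boundary_traces (phi phix phit : R * R -> R) (tl tr : R -> R)
    : Prop :=
  exists u : nat -> R * R -> R,
    [/\ forall n, smooth_solution (u n),
        L2_cvg (I_ start) (fun n => slice (u n) start) (slice phi start),
        L2_cvg (I_ start) (fun n => slice (dx (u n)) start) (slice phix start),
        L2_cvg (I_ start) (fun n => slice (dt (u n)) start) (slice phit start) &
        forall T, 0 <= T ->
          L2_cvg `[start, start + T] (fun n t => dx (u n) (- (l1 * t), t)) tl /\
          L2_cvg `[start, start + T] (fun n t => dx (u n) (l2 * t, t)) tr].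

Definition energy (phix phit : R * R -> R) (t : R) : R :=
  2^-1 * \int[mu]_(x in I_ t) (phix (x, t) ^+ 2 + phit (x, t) ^+ 2).

Definition boundary_integral (tl tr : R -> R) (T : R) : R :=
  \int[mu]_(t in `[start, start + T]) (tl t ^+ 2 + tr t ^+ 2).

Definition observable (T : R) : Prop :=
  exists2 C : R, 0 < C &
    forall (phi0 phi1 : R -> R) (phi phix phit : R * R -> R) (tl tr : R -> R),
      H10 (I_ start) phi0 -> L2 (I_ start) phi1 ->
      wave_solution phi0 phi1 phi phix phit ->
      boundary_traces phi phix phit tl tr ->
      energy phix phit start <= C * boundary_integral tl tr T.

Definition alpha : R := (1 + l1) / (1 - l2).
Definition beta : R := (1 + l2) / (1 - l1).

Definition obs_const : R :=
  (1 - Num.min l1 l2 ^+ 2) ^+ 2 * Num.max alpha beta /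
  (4 * (1 - Num.max l1 l2)).

Definition T_tilde : R := Num.max (L0 / (1 - l1)) (L0 / (1 - l2)).

End WaveProblem.

(* Main.v *)
Require Import Defs.
From mathcomp Require Import all_boot all_order all_algebra.
From mathcomp Require Import all_classical all_reals all_analysis.
From mathcomp Require Import measurable_realfun ring lra.

(** Smooth solutions are superpositions of two travelling waves: with [P] and
    [S] the values of [u_t + u_x] and [u_t - u_x], which are functions of [t + x]
    and [t - x] (lemma [riemann_invariants]), the boundary conditions say that
    [P] is a constant multiple of the trace of [u_x] on the left boundary and
    [S] of the one on the right boundary. So both the initial energy and the
    boundary integral are combinations of integrals of [P ^+ 2] and [S ^+ 2],
    over explicit intervals (lemma [smooth_identities]).

    From this the two inequalities are read off. Once [T >= T_tilde], the
    intervals of the boundary integral contain those of the energy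
    ([smooth_observability]). For the direct inequality, a reflection at a
    boundary turns [S] into [P] or [P] into [S] and multiplies the integral of
    the square by [(1 - l2) / (1 + l2)] or [(1 - l1) / (1 + l1)]
    ([reflection_bound]); as the product of these factors is less than [1], the
    contributions of all reflections are bounded by a multiple of the energy,
    uniformly in time ([smooth_direct]). General solutions are covered because
    traces are by definition limits of traces of smooth solutions, and both
    sides of the inequalities are continuous for that convergence
    ([boundary_traces_limit]).

    Conversely, if [T < T_tilde], some characteristics that start in the initial
    interval reach their boundary only after the time [t0 + T]. Data carried by
    them leave no trace until then ([silent_profile], [silent_solution]). To
    exhibit such a solution for all times, two reflections together act on the
    profile as a dilation of the variable, so one takes a [C^2] bump that is
    periodic in the logarithm of the variable ([log_periodic_bump]). The
    resulting classical solution is then shown to be a solution in the weak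
    sense: membership in [H10] by cutting off near the end points
    ([H10_of_C1]), continuity in time by dominated convergence
    ([L2_continuous_travelling]), and the distributional equations by
    integration over a large square ([weak_wave]). *)

Import Order.TTheory GRing.Theory Num.Theory.
Import numFieldNormedType.Exports.

Local Open Scope classical_set_scope.
Local Open Scope ring_scope.

(** * Integrals of continuous functions *)

Section continuous_integrals.
Context {R : realType}.
Local Notation mu := (@lebesgue_measure R).
Implicit Types (f g F : R -> R) (a b c k : R).

Lemma continuous_integrable f a b : continuous f ->
  mu.-integrable `[a, b] (EFin \o f).
Proof.
move=> cf; apply: continuous_compact_integrable; first exact: segment_compact.
exact: continuous_subspaceT.
Qed.

Lemma Rintegral_itv_oo_cc f a b : continuous f ->
  \int[mu]_(x in `]a, b[) f x = \int[mu]_(x in `[a, b]) f x.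
Proof.
move=> cf; have i := continuous_integrable _ a b cf.
rewrite Rintegral_itv_bndo_bndc; last first.
  by apply: integrableS i => // x /=; rewrite !in_itv/=; lra.
rewrite Rintegral_itv_obnd_cbnd //.
by apply: integrableS i => // x /=; rewrite !in_itv/=; lra.
Qed.

Lemma Rintegral_itv_cat f a b c : continuous f -> a <= b -> b <= c ->
  \int[mu]_(x in `[a, c]) f x =
  \int[mu]_(x in `[a, b]) f x + \int[mu]_(x in `[b, c]) f x.
Proof.
move=> cf ab bc.
have := @Rintegral_itvB R f (BLeft a) (BRight c) b (continuous_integrable f a c cf).
rewrite !bnd_simp => /(_ ab bc).
rewrite Rintegral_itv_obnd_cbnd; last first.
  apply: integrableS (continuous_integrable f b c cf) => //.
  by move=> x /=; rewrite !in_itv/=; lra.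
by move=> <-; rewrite addrC subrK.
Qed.

Lemma Rintegral_itv_sub f a b c d : continuous f -> (forall x, 0 <= f x) ->
  a <= c -> c <= d -> d <= b ->
  \int[mu]_(x in `[c, d]) f x <= \int[mu]_(x in `[a, b]) f x.
Proof.
move=> cf f0 ac cd db.
rewrite (Rintegral_itv_cat f a c b) ?(Rintegral_itv_cat f c d b)//; last first.
  exact: le_trans db.
have h u v : 0 <= \int[mu]_(x in `[u, v]) f x by apply: Rintegral_ge0 => *.
by rewrite -[leLHS]add0r lerD ?h// lerDl h.
Qed.

(** Asking for derivatives at the end points too makes the one-sided limits of
    the fundamental theorem automatic, which is all that globally defined [F]
    and [f] need. *)
Lemma Rintegral_derive F f a b : a <= b -> continuous f ->
  (forall x, a <= x <= b -> is_derive x 1 F (f x)) ->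
  \int[mu]_(x in `[a, b]) f x = F b - F a.
Proof.
rewrite le_eqVlt => /orP[/eqP-> *|ab cf dF].
  by rewrite set_itv1 Rintegral_set1 subrr.
have cF x : a <= x <= b -> {for x, continuous F}.
  move=> /dF[dF1 _]; apply: differentiable_continuous.
  exact/derivable1_diffP.
rewrite /Rintegral (@continuous_FTC2 _ f F)//.
- exact: continuous_subspaceT.
- split.
  + move=> x; rewrite in_itv/= => /andP[ax xb].
    by case: (dF x); rewrite ?(ltW ax) ?(ltW xb).
  + by apply: cvg_at_right_filter; apply: cF; rewrite lexx ltW.
  + by apply: cvg_at_left_filter; apply: cF; rewrite lexx ltW.
- move=> x; rewrite in_itv/= => /andP[ax xb]; rewrite derive1E.
  by apply: derive_val; apply: dF; rewrite ?(ltW ax) ?(ltW xb).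
Qed.

Lemma primitive f (lo : R) : continuous f ->
  exists F, forall x, lo < x -> is_derive x 1 F (f x).
Proof.
move=> cf; exists (fun x => \int[mu]_(t in `[lo, x]) f t) => x lox.
have xx : x < x + 1 by rewrite ltrDl.
have [|dF F'] := @continuous_FTC1_closed R f lo x (x + 1) xx _ lox (cf x).
  exact: continuous_integrable.
by apply: DeriveDef; rewrite -?derive1E.
Qed.

Lemma continuous_affine f k c : continuous f -> continuous (fun t => f (k * t + c)).
Proof.
move=> cf x; apply: (@continuous_comp _ _ _ (fun t => k * t + c) f); last exact: cf.
by apply: cvgD; [apply: cvgM; [exact: cvg_cst|exact: cvg_id]|exact: cvg_cst].
Qed.

Lemma continuous_scale f k : continuous f -> continuous (fun x => k * f x).
Proof. by move=> cf x; apply: cvgM; [exact: cvg_cst|exact: cf]. Qed.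

Lemma continuous_sqr f : continuous f -> continuous (fun x => f x ^+ 2).
Proof. by move=> cf x; exact: (cvgM (cf x) (cf x)). Qed.

Lemma is_derive_affine F (D : R) k c x : is_derive (k * x + c) 1 F D ->
  is_derive x 1 (fun t => F (k * t + c)) (k * D).
Proof.
move=> dF.
have d : is_derive x 1 (fun t => k * t + c) k.
  by apply: is_derive_eq; rewrite addr0 /GRing.scale/= mulr1.
have := @is_derive1_comp _ F (fun t => k * t + c) x _ _ dF d.
by rewrite mulrC.
Qed.

(** A primitive [F] of [f] composed with [t |-> k * t + c] is, up to the factor
    [k^-1], a primitive of the integrand for either sign of [k]; so both the
    increasing and the decreasing substitution follow. *)
Lemma Rintegral_affine_primitive f a b k c : continuous f -> a <= b -> k != 0 ->
  forall F, (forall x, a <= x <= b -> is_derive (k * x + c) 1 F (f (k * x + c))) ->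
  \int[mu]_(t in `[a, b]) f (k * t + c) = k^-1 * (F (k * b + c) - F (k * a + c)).
Proof.
move=> cf ab k0 F dF.
apply: etrans (Rintegral_derive (fun t => k^-1 * F (k * t + c)) _ _ _ ab _ _) _.
- exact: continuous_affine.
- move=> x xab.
  have d := is_derive_affine _ _ _ _ _ (dF x xab).
  have := @is_deriveZ _ _ _ _ k^-1 x 1 _ d.
  by rewrite /GRing.scale/= mulKf.
- by rewrite mulrBr.
Qed.

Lemma Rintegral_affine f a b k c : continuous f -> a <= b -> 0 < k ->
  \int[mu]_(t in `[a, b]) f (k * t + c) =
  k^-1 * \int[mu]_(s in `[k * a + c, k * b + c]) f s.
Proof.
move=> cf ab k0.
have [F dF] := primitive f (k * a + c - 1) cf.
have h x : a <= x -> k * a <= k * x by rewrite ler_pM2l.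
apply: etrans (Rintegral_affine_primitive f a b k c cf ab _ F _) _.
- by rewrite gt_eqF.
- move=> x /andP[ax _]; apply: dF; have := h _ ax; lra.
congr (_ * _); apply/esym; apply: Rintegral_derive => //.
- by have := h _ ab; lra.
- by move=> x /andP[ax _]; apply: dF; lra.
Qed.

Lemma Rintegral_reflect f a b c : continuous f -> a <= b ->
  \int[mu]_(t in `[a, b]) f (c - t) = \int[mu]_(s in `[c - b, c - a]) f s.
Proof.
move=> cf ab.
have [F dF] := primitive f (c - b - 1) cf.
transitivity (\int[mu]_(t in `[a, b]) f (- 1 * t + c)).
  by apply: eq_Rintegral => x _; rewrite mulN1r addrC.
apply: etrans (Rintegral_affine_primitive f a b (- 1) c cf ab _ F _) _.
- by lra.
- by move=> x /andP[_ xb]; apply: dF; lra.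
apply/esym; apply: etrans (Rintegral_derive F _ _ _ _ cf _) _; first last.
- by rewrite invrN1 !mulN1r opprB ![- _ + c]addrC.
- by move=> x /andP[ax _]; apply: dF; lra.
- by lra.
Qed.

End continuous_integrals.

(** * The L^2 norm *)

Section L2_norm.
Context {R : realType}.
Local Notation mu := (@lebesgue_measure R).
Implicit Types (f g h : R -> R) (a b c C : R) (D : set R).

Lemma ler_norm_sqr (x C : R) : `|x| <= C -> x ^+ 2 <= C ^+ 2.
Proof.
by move=> xC; rewrite -real_normK ?num_real// lerXn2r// nnegrE// (le_trans _ xC).
Qed.

(** Turns the extended-real norm into a real square root, on which continuity
    and order can be used. *)
Lemma Lnorm2_sqrt h : h \in Lfun mu 2%:E ->
  Lnorm mu 2%:E (EFin \o h) = (Num.sqrt (\int[mu]_x (h x ^+ 2)))%:E.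
Proof.
move=> hL; have hi := Lfun2_integrable_sqr hL.
rewrite unlock /=.
under eq_integral do rewrite /= powR_mulrn// -normrX ger0_norm ?sqr_ge0//.
rewrite -(fineK (integrable_fin_num measurableT hi)) poweR_EFin powR12_sqrt//.
by apply: Rintegral_ge0 => x _; rewrite sqr_ge0.
Qed.

Lemma L2_integrable_sqr D f : measurable D -> L2 D f ->
  mu.-integrable D (fun x => (f x ^+ 2)%:E).
Proof.
move=> mD /Lfun2_integrable_sqr i.
rewrite integrable_mkcond//.
apply: eq_integrable i => // x _ /=.
by rewrite /patch; case: ifPn => // _; rewrite expr0n.
Qed.

Lemma Rintegral_sqr_restrict D f :
  \int[mu]_x ((f \_ D) x ^+ 2) = \int[mu]_(x in D) (f x ^+ 2).
Proof.
rewrite [RHS]Rintegral_mkcond; apply: eq_Rintegral => x _.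
by rewrite /patch; case: ifPn => // _; rewrite expr0n.
Qed.

Lemma L2_of_bounded D f a b C : measurable D -> measurable_fun D f ->
  D `<=` `[a, b] -> (forall x, D x -> `|f x| <= C) -> L2 D f.
Proof.
move=> mD mf Dab fC; rewrite /L2.
have mfD : measurable_fun setT (f \_ D).
  exact: (measurable_restrictT f mD).1 mf.
rewrite inE; apply/andP; split; rewrite inE/=; first exact: mfD.
rewrite /finite_norm unlock.
apply: poweR_lty; rewrite /=.
have C2 x : D x -> f x ^+ 2 <= C ^+ 2.
  by move=> /fC; exact: ler_norm_sqr.
apply: (@le_lt_trans _ _ (\int[mu]_(x in `[a, b]) (C ^+ 2)%:E)%E).
  rewrite [leRHS]integral_mkcond; apply: ge0_le_integral => //.
  - apply/measurable_EFinP.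
    apply: (measurableT_comp (measurable_powR _)) => //.
    exact: measurableT_comp.
  - exact: (measurable_restrictT (cst (C ^+ 2)%:E) (measurable_itv _)).1 (measurable_cst _).
  - move=> x _; rewrite /= powR_mulrn// -normrX ger0_norm ?sqr_ge0//.
    rewrite /patch; case: ifPn => [|_]; last first.
      by rewrite expr0n/=; case: ifPn => // _; rewrite lee_fin sqr_ge0.
    by move=> /set_mem Dx; rewrite mem_set ?lee_fin ?C2//; exact: Dab.
rewrite integral_cst//= lebesgue_measure_itv/=.
by case: ifPn => _; rewrite ?mule0 // -EFinD -EFinM ltry.
Qed.

(** Dominated convergence, with the constant [C ^+ 2] on [`[a, b]] as the
    dominating function of the squares. *)
Lemma Lnorm2_cvg0 (h : nat -> R -> R) a b C :
  (forall n, measurable_fun setT (h n)) ->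
  (forall n x, ~ `[a, b]%classic x -> h n x = 0) ->
  (forall n x, `|h n x| <= C) ->
  {ae mu, forall x, h ^~ x @ \oo --> (0 : R)} ->
  Lnorm mu 2%:E (EFin \o h n) @[n --> \oo] --> 0%E.
Proof.
move=> mh h0 hC hcv.
have hL n : h n \in Lfun mu 2%:E.
  have -> : h n = h n \_ `[a, b].
    apply/funext => x; rewrite /patch; case: ifPn => // /negP.
    by rewrite inE => /h0.
  apply: (@L2_of_bounded `[a, b] (h n) a b C) => //.
  exact: measurable_funTS.
suff cv : \int[mu]_x (h n x ^+ 2) @[n --> \oo] --> (0 : R).
  rewrite (_ : (fun n => _) = (fun n => (Num.sqrt (\int[mu]_x (h n x ^+ 2)))%:E)); last first.
    by apply/funext => n; rewrite Lnorm2_sqrt.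
  apply: cvg_EFin; first exact: nearW.
  rewrite -[X in _ --> X](@sqrtr0 R).
  by apply: continuous_cvg => //; exact: sqrt_continuous.
have C2 n x : h n x ^+ 2 <= C ^+ 2 by exact: ler_norm_sqr.
have [] := @dominated_convergence _ _ _ mu `[a, b]%classic (measurable_itv _)
  (fun n x => (h n x ^+ 2)%:E) (cst 0%E) (cst (C ^+ 2)%:E).
- move=> n; apply/measurable_EFinP/measurable_funX; exact: (measurable_funTS (mh n)).
- exact: measurable_cst.
- have [N [mN N0 sN]] := hcv; exists N; split=> //; apply: subset_trans sN.
  apply: subsetC => x /= hx _.
  apply: cvg_EFin; first exact: nearW.
  by rewrite -[X in _ --> X](mulr0 (0 : R)); exact: (cvgM hx hx).
- exact: (continuous_integrable (fun=> C ^+ 2) a b (@cst_continuous _ _ _)).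
- apply/aeW => x n _; rewrite /= lee_fin ger0_norm ?sqr_ge0//.
move=> _ _; rewrite integral_cst// mul0e => /fine_cvg /= cv.
apply: cvg_trans cv; apply: near_eq_cvg; apply: nearW => n /=.
rewrite /Rintegral [in LHS]integral_mkcond/=; congr fine.
apply: eq_integral => x _; rewrite /patch; case: ifPn => // /negP.
by rewrite inE => /h0 ->; rewrite expr0n.
Qed.

Lemma L2_cvg_bounded D (u : nat -> R -> R) f a b C :
  measurable D -> D `<=` `[a, b] ->
  (forall n, measurable_fun D (u n)) -> measurable_fun D f ->
  (forall n x, D x -> `|u n x| <= C) -> (forall x, D x -> `|f x| <= C) ->
  (forall x, D x -> u ^~ x @ \oo --> f x) ->
  L2_cvg D u f.
Proof.
move=> mD Dab mu_ mf uC fC cv; split.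
- by move=> n; apply: (L2_of_bounded _ _ a b C) => // x; exact: uC.
- exact: (L2_of_bounded _ _ a b C).
have out x : ~ `[a, b]%classic x -> x \in D = false.
  by move=> nx; apply/negP; rewrite inE => /Dab.
apply: (@Lnorm2_cvg0 (fun n x => (u n \_ D) x - (f \_ D) x) a b (`|C| + `|C|)).
- move=> n; apply: measurable_funB.
    exact: (measurable_restrictT (u n) mD).1 (mu_ n).
  exact: (measurable_restrictT f mD).1 mf.
- by move=> n x nx; rewrite /patch out// subrr.
- move=> n x; rewrite /patch; case: ifPn => [/set_mem Dx|_].
    rewrite (le_trans (ler_normB _ _))// lerD// (le_trans _ (ler_norm _))//.
      exact: uC.
    exact: fC.
  by rewrite subrr normr0 addr_ge0.
- apply/aeW => x; rewrite /patch; case: ifPn => [/set_mem Dx|_].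
    by apply/subr_cvg0/cv.
  by rewrite subrr; exact: cvg_cst.
Qed.

Lemma L2_continuous_fun D f a b : measurable D -> D `<=` `[a, b] ->
  continuous f -> L2 D f.
Proof.
move=> mD Dab cf.
have [C fC] : exists C, forall x, `[a, b]%classic x -> `|f x| <= C.
  have := @segment_compact _ a b => /(continuous_compact (continuous_subspaceT cf)).
  move=> /compact_bounded [M [_ /(_ (M + 1)) H]].
  exists (M + 1) => x xab; apply: H; first by rewrite ltrDl.
  by exists x.
apply: (L2_of_bounded _ _ a b C) => //; last by move=> x /Dab; exact: fC.
by apply: measurable_funTS; exact: continuous_measurable_fun.
Qed.

Lemma L2_cvg_cst D f : L2 D f -> L2_cvg D (fun=> f) f.
Proof.
move=> Lf; split=> //; rewrite /L2_dist.
rewrite (_ : (fun _ => _) = fun=> 0%E); first exact: cvg_cst.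
apply/funext => _; rewrite -[RHS](@Lnorm0 _ _ _ mu 2%:E)//.
by apply: eq_Lnorm => x /=; rewrite subrr.
Qed.

Lemma Lfun2B h g : h \in Lfun mu 2%:E -> g \in Lfun mu 2%:E ->
  (h \- g) \in Lfun mu 2%:E.
Proof.
move=> hL gL; have p1 : (1 <= 2%:E :> \bar R)%E by rewrite lee1n.
have [_ addL] := @Lfun_addr_closed _ _ _ mu _ p1.
exact: addL hL (@Lfun_oppr_closed _ _ _ mu _ _ gL).
Qed.

(** By Minkowski's inequality the norms converge, hence so do their squares. *)
Lemma L2_cvg_int_sqr D (u : nat -> R -> R) f : L2_cvg D u f ->
  \int[mu]_(x in D) (u n x ^+ 2) @[n --> \oo] --> \int[mu]_(x in D) (f x ^+ 2).
Proof.
move=> [Lu Lf cv].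
pose N h := Num.sqrt (\int[mu]_x (h x ^+ 2)).
have NE h : N h ^+ 2 = \int[mu]_x (h x ^+ 2).
  by rewrite sqr_sqrtr//; apply: Rintegral_ge0 => x _; rewrite sqr_ge0.
have tri h g : h \in Lfun mu 2%:E -> g \in Lfun mu 2%:E -> N h <= N (h \- g) + N g.
  move=> hL gL; have dL := Lfun2B _ _ hL gL.
  have := @eminkowski _ _ _ mu (h \- g) g 2%:E.
  rewrite (_ : (h \- g \+ g)%R = h); last by apply/funext => x /=; rewrite subrK.
  rewrite !Lnorm2_sqrt// -EFinD !lee_fin; apply.
  - by move: dL; rewrite inE => /andP[/[!inE]].
  - by move: gL; rewrite inE => /andP[/[!inE]].
  - by rewrite ler1n.
have sym h g : N (h \- g) = N (g \- h).
  by congr Num.sqrt; apply: eq_Rintegral => x _ /=; rewrite -sqrrN opprB.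
have cN : N (u n \_ D \- f \_ D) @[n --> \oo] --> (0 : R).
  move: cv; rewrite /L2_dist.
  rewrite (_ : (fun n => _) = (fun n => (N (u n \_ D \- f \_ D))%:E)).
    by move/fine_cvg.
  apply/funext => n; rewrite -Lnorm2_sqrt//.
  by apply: Lfun2B; [exact: Lu|exact: Lf].
have cN2 : N (u n \_ D) @[n --> \oo] --> N (f \_ D).
  apply/cvgrPdist_le => e e0; move/cvgrPdist_le : cN => /(_ _ e0).
  apply: filterS => n; rewrite sub0r normrN => h.
  have := le_trans (ler_norm _) h; rewrite ler_norml => d.
  have := tri _ _ (Lu n) Lf; have := tri _ _ Lf (Lu n); rewrite (sym (f \_ D)).
  lra.
rewrite -Rintegral_sqr_restrict -NE.
under eq_fun do rewrite -Rintegral_sqr_restrict -NE.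
exact: (cvgM cN2 cN2).
Qed.

End L2_norm.

(** * Functions of two variables with continuous partial derivatives *)

Section partial_derivatives.
Context {R : realType}.
Implicit Types (u : R * R -> R) (x t : R) (O : set (R * R)).

Lemma nbhs_box x t (A : set (R * R)) : nbhs (x, t) A ->
  exists2 e, 0 < e & forall y s, `|y - x| < e -> `|s - t| < e -> A (y, s).
Proof.
move=> /nbhs_ballP[e /= e0 eA]; exists e => // y s yx st; apply: eA.
by split; rewrite /= /ball/= distrC.
Qed.

Lemma cvg_pairR (T : Type) (F : set_system T) {FF : Filter F} (f g : T -> R)
    (a b : R) : f @ F --> a -> g @ F --> b ->
  (fun y => (f y, g y)) @ F --> ((a, b) : R * R).
Proof. exact: (@cvg_pair _ _ _ F (nbhs a) (nbhs b) FF _ _ f g). Qed.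

Let dx_quotient u x t :
  (fun h : R => h^-1 *: (u (h *: ((1, 0) : R * R) + (x, t)) - u (x, t))) =
  (fun h : R => h^-1 *: (u (h *: 1 + x, t) - u (x, t))).
Proof.
apply/funext => h; congr (_ *: (u _ - _)).
by congr pair; rewrite /= /GRing.scale/= mulr0 add0r.
Qed.

Let dt_quotient u x t :
  (fun h : R => h^-1 *: (u (h *: ((0, 1) : R * R) + (x, t)) - u (x, t))) =
  (fun h : R => h^-1 *: (u (x, h *: 1 + t) - u (x, t))).
Proof.
apply/funext => h; congr (_ *: (u _ - _)).
by congr pair; rewrite /= /GRing.scale/= mulr0 add0r.
Qed.

Lemma is_derive_dx u x t : derivable u (x, t) ((1, 0) : R * R) ->
  is_derive x 1 (fun y => u (y, t)) (dx u (x, t)).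
Proof.
by rewrite /derivable /dx /derive /= dx_quotient => d; apply: DeriveDef.
Qed.

Lemma is_derive_dt u x t : derivable u (x, t) ((0, 1) : R * R) ->
  is_derive t 1 (fun s => u (x, s)) (dt u (x, t)).
Proof.
by rewrite /derivable /dt /derive /= dt_quotient => d; apply: DeriveDef.
Qed.

Lemma derivable_dx u x t D : is_derive x 1 (fun y => u (y, t)) D ->
  derivable u (x, t) ((1, 0) : R * R) /\ dx u (x, t) = D.
Proof. by move=> [d <-]; rewrite /derivable /dx /derive /= dx_quotient. Qed.

Lemma derivable_dt u x t D : is_derive t 1 (fun s => u (x, s)) D ->
  derivable u (x, t) ((0, 1) : R * R) /\ dt u (x, t) = D.
Proof. by move=> [d <-]; rewrite /derivable /dt /derive /= dt_quotient. Qed.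

Lemma addrK_l (a b : R) : a + b - a = b.
Proof. by rewrite addrAC subrr add0r. Qed.

(** The mean value theorem, without an order on the end points: the increments
    of the two variables have arbitrary signs below. *)
Lemma MVT_between (f df : R -> R) (a b : R) :
  (forall x, `|x - a| <= `|b - a| -> is_derive x 1 f (df x)) ->
  exists2 c, `|c - a| <= `|b - a| & f b - f a = df c * (b - a).
Proof.
move=> dF.
have cf x : `|x - a| <= `|b - a| -> {for x, continuous f}.
  by move=> /dF[df1 _]; apply: differentiable_continuous; exact/derivable1_diffP.
have [ab|ba] := leP a b.
- have h x : x \in `[a, b] -> `|x - a| <= `|b - a|.
    by rewrite in_itv/= => /andP[ax xb]; rewrite !ger0_norm ?subr_ge0// lerD2r.
  have [| |c cab ->] := @MVT_segment _ f df a b ab.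
  + by move=> x xab; apply/dF/h; move: xab; rewrite !in_itv/= => /andP[/ltW-> /ltW->].
  + by apply: continuous_in_subspaceT => x /set_mem/h/cf.
  + by exists c => //; exact: h.
- have h x : x \in `[b, a] -> `|x - a| <= `|b - a|.
    rewrite in_itv/= => /andP[bx xa]; rewrite !ler0_norm ?subr_le0//; last exact: ltW.
    by rewrite lerN2 lerD2r.
  have [| |c cab E] := @MVT_segment _ f df b a (ltW ba).
  + by move=> x xab; apply/dF/h; move: xab; rewrite !in_itv/= => /andP[/ltW-> /ltW->].
  + by apply: continuous_in_subspaceT => x /set_mem/h/cf.
  + by exists c; [exact: h|rewrite -opprB E -mulrN opprB].
Qed.

Lemma C1_near_box O u x t (e : R) : open O -> C1_on O u -> O (x, t) -> 0 < e ->
  exists2 d, 0 < d & forall y s, `|y - x| < d -> `|s - t| < d ->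
    [/\ O (y, s), `|dx u (y, s) - dx u (x, t)| < e &
        `|dt u (y, s) - dt u (x, t)| < e].
Proof.
move=> oO C1 Oz e0.
have [_ _ cx ct] := C1 _ Oz.
move/cvgrPdist_lt : cx => /(_ _ e0) nx.
move/cvgrPdist_lt : ct => /(_ _ e0) nt.
have [d d0 hd] := nbhs_box _ _ _ (filterI (open_nbhs_nbhs (conj oO Oz)) (filterI nx nt)).
exists d => // y s yx st; have [Oy [hx ht]] := hd y s yx st.
split; [exact: Oy|rewrite distrC; exact: hx|rewrite distrC; exact: ht].
Qed.

(** Moving first in [t], then in [x], writes the increment as two increments
    along the axes. *)
Lemma line_quotient_cvg O u x t p q : open O -> C1_on O u -> O (x, t) ->
  (fun h : R => h^-1 *: (u (x + p * h, t + q * h) - u (x, t))) @ 0^' -->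
    p * dx u (x, t) + q * dt u (x, t).
Proof.
move=> oO C1 Oz; apply/cvgrPdist_le => e e0.
(* the increment of [u] is controlled by (|p| + |q|) e / M *)
pose M := `|p| + `|q| + 1.
have M0 : 0 < M by rewrite /M; have := normr_ge0 p; have := normr_ge0 q; lra.
have [d d0 hd] := C1_near_box O u x t (e / M) oO C1 Oz (divr_gt0 e0 M0).
have dM0 : 0 < d / M by rewrite divr_gt0.
near=> h.
have h0 : h != 0 by near: h; exact: nbhs_dnbhs_neq.
have hdM : `|h| < d / M by near: h; exact: (@dnbhs0_lt _ R).
have ph : `|p * h| < d.
  rewrite normrM; move: hdM; rewrite ltr_pdivlMr// /M => hdM.
  have := normr_ge0 h; have := normr_ge0 q; nra.
have qh : `|q * h| < d.
  rewrite normrM; move: hdM; rewrite ltr_pdivlMr// /M => hdM.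
  have := normr_ge0 h; have := normr_ge0 p; nra.
have xx : `|x - x| < d by rewrite subrr normr0.
have tt : `|t + q * h - t| < d by rewrite addrK_l.
have [|c1 c1x E1] := MVT_between (fun y => u (y, t + q * h))
    (fun y => dx u (y, t + q * h)) x (x + p * h).
  move=> y; rewrite addrK_l => yx; apply: is_derive_dx.
  have [Oy _ _] := hd y _ (le_lt_trans yx ph) tt.
  by have [dy _ _ _] := C1 _ Oy; exact: dy.
have [|c2 c2t E2] := MVT_between (fun s => u (x, s))
    (fun s => dt u (x, s)) t (t + q * h).
  move=> s; rewrite addrK_l => st; apply: is_derive_dt.
  have [Oy _ _] := hd x s xx (le_lt_trans st qh).
  by have [_ dy _ _] := C1 _ Oy; exact: dy.
have -> : u (x + p * h, t + q * h) - u (x, t) =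
    h * (p * dx u (c1, t + q * h) + q * dt u (x, c2)).
  rewrite -(subrK (u (x, t + q * h)) (u (x + p * h, _))) -addrA E1 E2.
  by move: (dx u _) (dt u _) => a b; ring.
rewrite /GRing.scale/= mulKf//.
rewrite addrK_l in c1x; rewrite addrK_l in c2t.
have [_ b1 _] := hd c1 _ (le_lt_trans c1x ph) tt.
have [_ _ b2] := hd x c2 xx (le_lt_trans c2t qh).
move: (dx u (c1, _)) (dx u (x, t)) (dt u (x, c2)) (dt u (x, t)) b1 b2 {E1 E2}
  => a1 a a2 b b1 b2.
have -> : p * a + q * b - (p * a1 + q * a2) = - (p * (a1 - a) + q * (a2 - b)).
  by ring.
rewrite normrN (le_trans (ler_normD _ _))// !normrM.
apply: (@le_trans _ _ (`|p| * (e / M) + `|q| * (e / M))).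
  by apply: lerD; apply: ler_wpM2l => //; exact: ltW.
rewrite -mulrDl mulrA ler_pdivrMr// [leRHS]mulrC ler_wpM2r//; first exact: ltW.
by rewrite /M lerDl.
Unshelve. all: by end_near. Qed.

(** Continuity of the partial derivatives gives the chain rule along lines. *)
Lemma is_derive_line O u (x0 t0 p q r : R) : open O -> C1_on O u ->
  O (x0 + p * r, t0 + q * r) ->
  is_derive r 1 (fun s => u (x0 + p * s, t0 + q * s))
    (p * dx u (x0 + p * r, t0 + q * r) + q * dt u (x0 + p * r, t0 + q * r)).
Proof.
move=> oO C1 Oz; have := line_quotient_cvg _ _ _ _ p q oO C1 Oz.
rewrite (_ : (fun h => _) = (fun h : R => h^-1 *:
  (u (x0 + p * (h *: 1 + r), t0 + q * (h *: 1 + r)) - u (x0 + p * r, t0 + q * r)))).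
  move=> cv; apply: DeriveDef; last exact: cvg_lim cv.
  by apply/cvg_ex; eexists; exact: cv.
apply/funext => h; rewrite /GRing.scale/= mulr1; congr (_ * (u _ - _)).
by congr pair; ring.
Qed.

(** Schwarz: by two applications of the mean value theorem, in either order, the
    second difference of [u] over a small square of side [h] is [h ^+ 2] times
    a value of each of the mixed derivatives near [z]. *)
Lemma mixed_partials O u z : open O -> C2_on O u -> O z ->
  dt (dx u) z = dx (dt u) z.
Proof.
case: z => x t oO [C1 C1x C1t] Oz.
apply/eqP; rewrite -subr_eq0 -normr_le0; apply/ler_addgt0Pr => e e0.
rewrite add0r.
have e2 : 0 < e / 2 by rewrite divr_gt0.
have [d1 d10 h1] := C1_near_box O (dx u) x t _ oO C1x Oz e2.
have [d2 d20 h2] := C1_near_box O (dt u) x t _ oO C1t Oz e2.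
(* the square of side [h] at [z] must lie in both neighbourhoods *)
pose h := Num.min d1 d2 / 2.
have h0 : 0 < h by rewrite divr_gt0// lt_min d10.
have hd1 : h < d1 by rewrite /h; case: (leP d1 d2); lra.
have hd2 : h < d2 by rewrite /h; case: (leP d1 d2); lra.
have nh : `|h| = h by rewrite gtr0_norm.
have th1 : `|t + h - t| < d1 by rewrite addrK_l nh.
have tt1 : `|t - t| < d1 by rewrite subrr normr0.
have xh2 : `|x + h - x| < d2 by rewrite addrK_l nh.
have xx2 : `|x - x| < d2 by rewrite subrr normr0.
have [|a ax Ea] := MVT_between (fun y => u (y, t + h) - u (y, t))
    (fun y => dx u (y, t + h) - dx u (y, t)) x (x + h).
  move=> y; rewrite addrK_l nh => yx.
  have yd := le_lt_trans yx hd1.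
  have [Oy _ _] := h1 y (t + h) yd th1.
  have [Oy' _ _] := h1 y t yd tt1.
  have [dy _ _ _] := C1 _ Oy; have [dy' _ _ _] := C1 _ Oy'.
  exact: (@is_deriveB _ _ _ _ _ _ _ _ _ (is_derive_dx _ _ _ dy) (is_derive_dx _ _ _ dy')).
move: ax; rewrite addrK_l nh => ax.
have ad := le_lt_trans ax hd1.
have [|b bt Eb] := MVT_between (fun s => dx u (a, s)) (fun s => dt (dx u) (a, s)) t (t + h).
  move=> s; rewrite addrK_l nh => st; apply: is_derive_dt.
  have [Oy _ _] := h1 a s ad (le_lt_trans st hd1).
  have [_ dy _ _] := C1x _ Oy; exact: dy.
have [|a' ax' Ea'] := MVT_between (fun s => u (x + h, s) - u (x, s))
    (fun s => dt u (x + h, s) - dt u (x, s)) t (t + h).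
  move=> y; rewrite addrK_l nh => yx.
  have yd := le_lt_trans yx hd2.
  have [Oy _ _] := h2 (x + h) y xh2 yd.
  have [Oy' _ _] := h2 x y xx2 yd.
  have [_ dy _ _] := C1 _ Oy; have [_ dy' _ _] := C1 _ Oy'.
  exact: (@is_deriveB _ _ _ _ _ _ _ _ _ (is_derive_dt _ _ _ dy) (is_derive_dt _ _ _ dy')).
move: ax'; rewrite addrK_l nh => ax'.
have ad' := le_lt_trans ax' hd2.
have [|b' bt' Eb'] := MVT_between (fun y => dt u (y, a')) (fun y => dx (dt u) (y, a')) x (x + h).
  move=> s; rewrite addrK_l nh => st; apply: is_derive_dx.
  have [Oy _ _] := h2 s a' (le_lt_trans st hd2) ad'.
  have [dy _ _ _] := C1t _ Oy; exact: dy.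
have E : dt (dx u) (a, b) = dx (dt u) (b', a').
  apply: (mulIf (lt0r_neq0 h0)); apply: (mulIf (lt0r_neq0 h0)).
  rewrite !addrK_l in Ea Eb Ea' Eb'.
  move: (dt (dx u) _) (dx (dt u) _) (dx u (a, t + h)) (dx u (a, t))
    (dt u (x + h, a')) (dt u (x, a')) (u (x + h, t + h)) (u (x + h, t))
    (u (x, t + h)) (u (x, t)) Ea Eb Ea' Eb' => m m' p p' q q' u1 u2 u3 u4 Ea Eb Ea' Eb'.
  by rewrite -Eb -Eb' -Ea -Ea'; ring.
rewrite addrK_l nh in bt; rewrite addrK_l nh in bt'.
have [_ _ B1] := h1 a b ad (le_lt_trans bt hd1).
have [_ B2 _] := h2 b' a' (le_lt_trans bt' hd2) ad'.
rewrite E in B1; move: B1 B2.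
move: (dx (dt u) (b', a')) (dt (dx u) (x, t)) (dx (dt u) (x, t)) => m m1 m2 B1 B2.
apply: (le_trans (ler_distD m _ _)); rewrite [e]splitr.
by apply: lerD; [rewrite distrC; exact: ltW|exact: ltW].
Qed.

End partial_derivatives.

(** * Riemann invariants of smooth solutions *)

Section riemann_invariants.
Context {R : realType}.
Variables l1 l2 L0 : R.
Hypotheses (hl1 : 0 <= l1 < 1) (hl2 : 0 <= l2 < 1) (hl : 0 < l1 + l2)
  (hL : 0 < L0).
Local Notation t0 := (start l1 l2 L0).
Local Notation Q := (Q l1 l2 L0).
Local Notation Qbar := (Qbar l1 l2 L0).

Lemma start_gt0 : 0 < t0. Proof. by rewrite divr_gt0. Qed.

Lemma Qbar_left t : t0 <= t -> Qbar (- l1 * t, t).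
Proof.
move=> tt; have t1 := lt_le_trans start_gt0 tt.
split=> //=; rewrite mulNr lexx/=; have := mulr_gt0 hl t1; lra.
Qed.

Lemma Qbar_right t : t0 <= t -> Qbar (l2 * t, t).
Proof.
move=> tt; have t1 := lt_le_trans start_gt0 tt.
split=> //=; rewrite lexx andbT/=; have := mulr_gt0 hl t1; lra.
Qed.

(** For [s = 1] or [s = - 1] the wave operator factors as
    (d_t - s d_x)(d_t + s d_x), so [u_t + s u_x] is constant along the lines
    where [x + s t] is. Only the interior of the segment has to lie in [Q]: its
    end points are reached by continuity, which is what allows them to be on
    the boundary. *)
Lemma characteristic_cst (u : R * R -> R) (O : set (R * R)) (s x t t' : R) :
  open O -> C2_on O u -> (forall z, Q z -> dt (dt u) z - dx (dx u) z = 0) ->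
  s * s = 1 -> t <= t' ->
  (forall r, t <= r <= t' -> O (x - s * (r - t), r)) ->
  (forall r, t < r < t' -> Q (x - s * (r - t), r)) ->
  dt u (x, t) + s * dx u (x, t) =
  dt u (x - s * (t' - t), t') + s * dx u (x - s * (t' - t), t').
Proof.
move=> oO C2 eqn ss tt' inO inQ; have [C1 C1x C1t] := C2.
pose z r : R * R := (x + s * t + - s * r, 0 + 1 * r).
have zE r : z r = (x - s * (r - t), r) by congr pair; ring.
pose g r := dt u (z r) + s * dx u (z r).
pose dg r := (- s * dx (dt u) (z r) + 1 * dt (dt u) (z r)) +
   s * (- s * dx (dx u) (z r) + 1 * dt (dx u) (z r)).
have d r : t <= r <= t' -> is_derive r 1 g (dg r).
  move=> /inO; rewrite -zE => Oz; apply: is_deriveD.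
    exact: is_derive_line Oz.
  by apply: is_deriveZ; exact: is_derive_line Oz.
have [||c] := @MVT_segment _ g (fun=> 0) t t' tt'.
- move=> r; rewrite in_itv/= => /andP[r1 r2].
  have r12 : t <= r <= t' by rewrite !ltW.
  apply: is_derive_eq (d r r12) _.
  have Qz : Q (z r) by rewrite zE; apply: inQ; rewrite r1.
  have Oz : O (z r) by rewrite zE; exact: inO.
  have := eqn _ Qz; rewrite /dg (mixed_partials O u _ oO C2 Oz).
  move: (dt (dt u) (z r)) (dx (dx u) (z r)) (dx (dt u) (z r)) => utt uxx uxt e0.
  have -> : - s * uxt + 1 * utt + s * (- s * uxx + 1 * uxt) = utt - (s * s) * uxx.
    by ring.
  by rewrite ss mul1r.
- apply: continuous_in_subspaceT => r /set_mem; rewrite /= in_itv/= => r12.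
  have [dr _] := d r r12.
  by apply: differentiable_continuous; exact/derivable1_diffP.
- move=> _; rewrite mul0r /g !zE subrr mulr0 subr0 => /eqP.
  by rewrite subr_eq0 => /eqP.
Qed.

(** Differentiating [u (k * t, t) = 0] along the boundary. The equation is given
    only for [t > t0]; at [t0] the relation holds by continuity. *)
Lemma boundary_derivative (u : R * R -> R) (O : set (R * R)) (k : R) :
  open O -> C1_on O u -> (forall t, t0 <= t -> O (k * t, t)) ->
  (forall t, t0 < t -> u (k * t, t) = 0) ->
  forall t, t0 <= t -> dt u (k * t, t) = - k * dx u (k * t, t).
Proof.
move=> oO C1 inO u0.
pose g t := k * dx u (k * t, t) + dt u (k * t, t).
suff g0 t : t0 <= t -> g t = 0.
  by move=> t /g0; rewrite /g addrC mulNr => /eqP; rewrite addr_eq0 => /eqP.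
have gt0 r : t0 < r -> g r = 0.
  move=> r0.
  have zE s : (0 + k * s, 0 + 1 * s) = (k * s, s) by congr pair; ring.
  have := is_derive_line O u 0 0 k 1 r oO C1.
  rewrite zE mul1r => /(_ (inO _ (ltW r0))) [_ E]; rewrite /g -E.
  rewrite -[RHS](derive_cst (0 : R) r 1).
  apply: near_eq_derive.
  near=> s; rewrite zE; apply: u0; near: s.
  by apply: open_nbhs_nbhs; split; [exact: open_gt|].
rewrite le_eqVlt => /orP[/eqP <-|]; last exact: gt0.
have [_ _ cx ct] := C1 _ (inO _ (lexx _)).
have cz : (fun t => (k * t, t) : R * R) @ t0 --> ((k * t0, t0) : R * R).
  by apply: cvg_pairR; [exact: mulrl_continuous|exact: cvg_id].
have cg : g @ t0 --> g t0.
  apply: cvgD.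
    by apply: cvgM; [exact: cvg_cst|exact: (cvg_comp _ _ cz cx)].
  exact: (cvg_comp _ _ cz ct).
have c1 := cvg_at_right_filter cg.
have c2 : g @ t0^'+ --> (0 : R).
  apply: (@cvg_trans _ ((fun=> 0) @ t0^'+)); last exact: cvg_cst.
  apply: near_eq_cvg; near=> s; apply/esym/gt0; near: s; exact: nbhs_right_gt.
exact: cvg_unique c1 c2.
Unshelve. all: by end_near. Qed.

(** D'Alembert's decomposition at the level of derivatives. A characteristic
    [x + t = s] leaves [Q] through the left boundary at time [s / (1 - l1)], and
    [x - t = - s] through the right one at time [s / (1 - l2)]; the profiles [P]
    and [S] read the invariants there. *)
Lemma riemann_invariants (u : R * R -> R) : smooth_solution l1 l2 L0 u ->
  exists P S : R -> R, [/\ continuous P, continuous S,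
   (forall x t, Qbar (x, t) -> dt u (x, t) + dx u (x, t) = P (t + x)),
   (forall x t, Qbar (x, t) -> dt u (x, t) - dx u (x, t) = S (t - x)) &
   forall t, t0 <= t -> dt u (- l1 * t, t) = l1 * dx u (- l1 * t, t) /\
     dt u (l2 * t, t) = - l2 * dx u (l2 * t, t)].
Proof.
move=> [[V [oO QO C2]] eqn bc]; have [C1 C1x C1t] := C2.
have t00 := start_gt0.
have [/andP[l10 l11] /andP[l20 l21]] := (hl1, hl2).
have m1 : 0 < 1 - l1 by lra.
have m2 : 0 < 1 - l2 by lra.
(* the exit time, kept above [t0] so that the profiles are continuous on R *)
pose tau m s := Num.max t0 (s / m).
have tau_ge m s : t0 <= tau m s by rewrite /tau le_max lexx.
have ctau m : continuous (tau m).
  have -> : tau m = fun s => (t0 + m^-1 * s + `|t0 - m^-1 * s|) / 2.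
    by apply/funext => s; rewrite /tau maxr_absE [s / m]mulrC.
  move=> s; apply: cvgM; last exact: cvg_cst.
  apply: cvgD; first by apply: cvgD; [exact: cvg_cst|exact: mulrl_continuous].
  by apply: cvg_norm; apply: cvgB; [exact: cvg_cst|exact: mulrl_continuous].
have cz k m s : (fun s => (k * tau m s, tau m s) : R * R) @ s -->
     ((k * tau m s, tau m s) : R * R).
  apply: cvg_pairR; last exact: ctau.
  by apply: cvgM; [exact: cvg_cst|exact: ctau].
pose trace k m sg s := dt u (k * tau m s, tau m s) + sg * dx u (k * tau m s, tau m s).
have ctrace k m sg : (forall t, t0 <= t -> Qbar (k * t, t)) -> continuous (trace k m sg).
  move=> kQ s; have Oz := QO _ (kQ _ (tau_ge m s)).
  have [_ _ cxt ctt] := C1 _ Oz.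
  apply: cvgD; first exact: (cvg_comp _ _ (cz k m s) ctt).
  apply: cvgM; [exact: cvg_cst|exact: (cvg_comp _ _ (cz k m s) cxt)].
exists (trace (- l1) (1 - l1) 1), (trace l2 (1 - l2) (- 1)); split.
- by apply: ctrace; exact: Qbar_left.
- by apply: ctrace; exact: Qbar_right.
- move=> x t [/= tt /andP[x1 x2]].
  have E : tau (1 - l1) (t + x) = (t + x) / (1 - l1).
    by rewrite /tau max_r// ler_pdivlMr//; nra.
  have E' : (t + x) / (1 - l1) * (1 - l1) = t + x by rewrite divfK ?gt_eqF.
  rewrite /trace E; set t' := (t + x) / (1 - l1) in E' *.
  have t't : t <= t' by rewrite /t' ler_pdivlMr//; nra.
  have h r : t <= r <= t' -> - (l1 * r) <= x - 1 * (r - t) <= l2 * r /\ t0 <= r.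
    by move=> /andP[r1 r2]; split; [apply/andP; split; nra|lra].
  have xE : x - 1 * (t' - t) = - l1 * t' by nra.
  have := @characteristic_cst u V 1 x t t' oO C2 eqn (mulr1 _) t't.
  rewrite xE !mul1r; apply.
  + by move=> r /h[hr ?]; apply: QO; split => //=; rewrite -(mul1r (r - t)).
  + move=> r /andP[r1 r2].
    split=> /=; first lra.
    by rewrite /I_ /= in_itv /=; apply/andP; split; nra.
- move=> x t [/= tt /andP[x1 x2]].
  have E : tau (1 - l2) (t - x) = (t - x) / (1 - l2).
    by rewrite /tau max_r// ler_pdivlMr//; nra.
  have E' : (t - x) / (1 - l2) * (1 - l2) = t - x by rewrite divfK ?gt_eqF.
  rewrite /trace E; set t' := (t - x) / (1 - l2) in E' *.
  have t't : t <= t' by rewrite /t' ler_pdivlMr//; nra.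
  have xE : x - - 1 * (t' - t) = l2 * t' by nra.
  have := @characteristic_cst u V (- 1) x t t' oO C2 eqn _ t't.
  rewrite xE !mulN1r => -> //.
  + by rewrite opprK.
  + move=> r /andP[r1 r2]; apply: QO; split => /=; first lra.
    by apply/andP; split; nra.
  + move=> r /andP[r1 r2]; split=> /=; first lra.
    by rewrite /I_ /= in_itv /=; apply/andP; split; nra.
- move=> t tt; split.
    rewrite (boundary_derivative u V (- l1) oO C1)// ?opprK// => s st.
      exact/QO/Qbar_left.
    by rewrite mulNr; case: (bc s st).
  rewrite (boundary_derivative u V l2 oO C1)// => s st; first exact/QO/Qbar_right.
  by case: (bc s st).
Qed.

End riemann_invariants.

(** * The direct and the observability inequality *)

Section inequalities.
Context {R : realType}.
Local Notation mu := (@lebesgue_measure R).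
Variables l1 l2 : R.
Hypotheses (hl1 : 0 <= l1 < 1) (hl2 : 0 <= l2 < 1) (hl : 0 < l1 + l2).

(** The relation says that the boundary at which [S] arrives along the
    characteristics [m * t] sends it back as [P] along [p * t], with amplitude
    [- m / p]. The factor [m / p] left after the change of variable is less
    than [1] for a boundary that moves outwards. *)
Lemma reflection_bound (P S : R -> R) (p m q t0 t1 : R) : continuous P -> continuous S ->
  0 < p -> 0 < m -> 0 <= t0 <= t1 -> 0 < q <= p ->
  (forall t, t0 <= t -> p * P (p * t) = - (m * S (m * t))) ->
  \int[mu]_(s in `[q * t0, q * t1]) (P s ^+ 2) <=
  \int[mu]_(s in `[q * t0, p * t0]) (P s ^+ 2) +
    m / p * \int[mu]_(s in `[m * t0, m * t1]) (S s ^+ 2).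
Proof.
move=> cP cS p0 m0 /andP[t00 t01] /andP[q0 qp] rel.
have cP2 := continuous_sqr _ cP; have cS2 := continuous_sqr _ cS.
have t10 : 0 <= t1 by exact: le_trans t01.
apply: (@le_trans _ _ (\int[mu]_(s in `[q * t0, p * t1]) (P s ^+ 2))).
  apply: Rintegral_itv_sub => //.
  - by move=> x; exact: sqr_ge0.
  - by rewrite ler_pM2l.
  - exact: ler_wpM2r.
rewrite (Rintegral_itv_cat _ _ (p * t0))//; first last.
- by rewrite ler_pM2l.
- exact: ler_wpM2r.
rewrite lerD2l le_eqVlt; apply/orP; left; apply/eqP.
have := Rintegral_affine _ t0 t1 p 0 cP2 t01 p0.
have := Rintegral_affine _ t0 t1 m 0 cS2 t01 m0.
rewrite !addr0 => eS eP.
have : \int[mu]_(t in `[t0, t1]) (P (p * t + 0) ^+ 2) =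
   (m / p) ^+ 2 * \int[mu]_(t in `[t0, t1]) (S (m * t + 0) ^+ 2).
  rewrite -RintegralZl//; last first.
    exact: (continuous_integrable _ _ _ (continuous_affine _ m 0 cS2)).
  apply: eq_Rintegral => t /set_mem /=; rewrite in_itv/= => /andP[tt _].
  rewrite !addr0 -exprMn -[RHS]sqrrN; congr (_ ^+ 2).
  apply: (mulfI (lt0r_neq0 p0)); rewrite (rel t tt).
  by rewrite mulrN mulrA mulrCA divff ?gt_eqF// mulr1.
rewrite eS eP => e.
apply: (mulfI (lt0r_neq0 (_ : 0 < p^-1))); rewrite ?invr_gt0// e.
have n1 := lt0r_neq0 p0; have n2 := lt0r_neq0 m0.
by move: (\int[mu]_(_ in _) _) => y; field; rewrite ?n1 ?n2.
Qed.

Section fixed_L0.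
Variable L0 : R.
Hypothesis hL : 0 < L0.
Local Notation t0 := (start l1 l2 L0).

(** Energy and boundary integral in terms of the two profiles. On the left
    boundary [u_t = l1 u_x], so [P = (1 + l1) u_x] there, and [P] at
    [(1 - l1) t] is the trace at time [t]; hence the boundary integral measures
    [P ^+ 2] over [(1 - l1) t0, (1 - l1) (t0 + T)], where the energy measures it
    over the initial interval. The right boundary and [S] are the mirror
    image, and eliminating [u_x] gives the two reflection laws. *)
Lemma smooth_identities (u : R * R -> R) : smooth_solution l1 l2 L0 u ->
  exists P S : R -> R, [/\ continuous P, continuous S,
    energy l1 l2 (dx u) (dt u) t0 =
      4^-1 * (\int[mu]_(s in `[(1 - l1) * t0, (1 + l2) * t0]) (P s ^+ 2) +
              \int[mu]_(s in `[(1 - l2) * t0, (1 + l1) * t0]) (S s ^+ 2)),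
    (forall T, 0 <= T -> boundary_integral l1 l2 L0
        (fun t => dx u (- (l1 * t), t)) (fun t => dx u (l2 * t, t)) T =
      ((1 + l1) ^+ 2 * (1 - l1))^-1 *
        \int[mu]_(s in `[(1 - l1) * t0, (1 - l1) * (t0 + T)]) (P s ^+ 2) +
      ((1 + l2) ^+ 2 * (1 - l2))^-1 *
        \int[mu]_(s in `[(1 - l2) * t0, (1 - l2) * (t0 + T)]) (S s ^+ 2)) &
    forall t, t0 <= t ->
      (1 + l2) * P ((1 + l2) * t) = - ((1 - l2) * S ((1 - l2) * t)) /\
      (1 + l1) * S ((1 + l1) * t) = - ((1 - l1) * P ((1 - l1) * t))].
Proof.
move=> su; have [P [S [cP cS uP uS ub]]] := riemann_invariants _ _ _ hl1 hl2 hl hL u su.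
have t00 : 0 < t0 := start_gt0 _ _ _ hl hL.
have [/andP[l10 l11] /andP[l20 l21]] := (hl1, hl2).
have cP2 := continuous_sqr _ cP; have cS2 := continuous_sqr _ cS.
have QL := Qbar_left _ _ _ hl hL; have QR := Qbar_right _ _ _ hl hL.
have PL t : t0 <= t -> P ((1 - l1) * t) = (1 + l1) * dx u (- l1 * t, t).
  move=> tt; have := uP _ _ (QL t tt); have [-> _] := ub t tt.
  have -> : t + - l1 * t = (1 - l1) * t by ring.
  by move: (dx u _) => p <-; ring.
have SL t : t0 <= t -> S ((1 + l1) * t) = - (1 - l1) * dx u (- l1 * t, t).
  move=> tt; have := uS _ _ (QL t tt); have [-> _] := ub t tt.
  have -> : t - - l1 * t = (1 + l1) * t by ring.
  by move: (dx u _) => p <-; ring.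
have PR t : t0 <= t -> P ((1 + l2) * t) = (1 - l2) * dx u (l2 * t, t).
  move=> tt; have := uP _ _ (QR t tt); have [_ ->] := ub t tt.
  have -> : t + l2 * t = (1 + l2) * t by ring.
  by move: (dx u _) => p <-; ring.
have SR t : t0 <= t -> S ((1 - l2) * t) = - (1 + l2) * dx u (l2 * t, t).
  move=> tt; have := uS _ _ (QR t tt); have [_ ->] := ub t tt.
  have -> : t - l2 * t = (1 - l2) * t by ring.
  by move: (dx u _) => p <-; ring.
have ll0 : - (l1 * t0) <= l2 * t0 by have := mulr_gt0 hl t00; lra.
exists P, S; split=> //.
- rewrite /energy.
  pose g x := 2^-1 * P (1 * x + t0) ^+ 2 + 2^-1 * S (t0 - x) ^+ 2.
  have cP1 := continuous_affine _ 1 t0 cP2.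
  have cS1 : continuous (fun x => S (t0 - x) ^+ 2).
    have -> : (fun x => S (t0 - x) ^+ 2) = (fun x => S (- 1 * x + t0) ^+ 2).
      by apply/funext => x; rewrite mulN1r addrC.
    exact: (continuous_affine _ (- 1) t0 cS2).
  have -> : \int[mu]_(x in I_ l1 l2 t0) (dx u (x, t0) ^+ 2 + dt u (x, t0) ^+ 2) =
      \int[mu]_(x in I_ l1 l2 t0) g x.
    apply: eq_Rintegral => x /set_mem; rewrite /I_ /= in_itv /= => /andP[x1 x2].
    have Qx : Qbar l1 l2 L0 (x, t0) by split=> //=; rewrite !ltW.
    rewrite /g mul1r [x + t0]addrC -(uP _ _ Qx) -(uS _ _ Qx).
    by move: (dx u _) (dt u _) => p q; field.
  rewrite /I_ Rintegral_itv_oo_cc; last first.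
    by move=> x; apply: cvgD; [exact: continuous_scale cP1 x|exact: continuous_scale cS1 x].
  rewrite RintegralD//; first last.
  + exact: (continuous_integrable _ _ _ (continuous_scale _ _ cS1)).
  + exact: (continuous_integrable _ _ _ (continuous_scale _ _ cP1)).
  rewrite !RintegralZl//; first last.
  + exact: (continuous_integrable _ _ _ cP1).
  + exact: (continuous_integrable _ _ _ cS1).
  rewrite (Rintegral_affine (fun s => P s ^+ 2))// (Rintegral_reflect (fun s => S s ^+ 2))//.
  have -> : 1 * - (l1 * t0) + t0 = (1 - l1) * t0 by ring.
  have -> : 1 * (l2 * t0) + t0 = (1 + l2) * t0 by ring.
  have -> : t0 - - (l1 * t0) = (1 + l1) * t0 by ring.
  have -> : t0 - l2 * t0 = (1 - l2) * t0 by ring.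
  by move: (\int[mu]_(_ in _) _) (\int[mu]_(_ in _) _) => A B; field.
- move=> T T0; rewrite /boundary_integral.
  pose gP t := P ((1 - l1) * t + 0) ^+ 2; pose gS t := S ((1 - l2) * t + 0) ^+ 2.
  have cgP : continuous gP := continuous_affine _ (1 - l1) 0 cP2.
  have cgS : continuous gS := continuous_affine _ (1 - l2) 0 cS2.
  transitivity (\int[mu]_(t in `[t0, t0 + T])
     (((1 + l1) ^+ 2)^-1 * gP t + ((1 + l2) ^+ 2)^-1 * gS t)).
    apply: eq_Rintegral => t /set_mem /=; rewrite in_itv/= => /andP[tt _].
    rewrite /gP /gS !addr0 PL// SR// mulNr !exprMn.
    have n1 : 1 + l1 != 0 by rewrite gt_eqF//; lra.
    have n2 : 1 + l2 != 0 by rewrite gt_eqF//; lra.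
    by move: (dx u _) (dx u _) => p q; field; rewrite ?n1 ?n2.
  rewrite RintegralD//; first last.
  + exact: (continuous_integrable _ _ _ (continuous_scale _ _ cgS)).
  + exact: (continuous_integrable _ _ _ (continuous_scale _ _ cgP)).
  rewrite !RintegralZl//; first last.
  + exact: (continuous_integrable _ _ _ cgP).
  + exact: (continuous_integrable _ _ _ cgS).
  rewrite (Rintegral_affine (fun s => P s ^+ 2)) ?(Rintegral_affine (fun s => S s ^+ 2))//;
    rewrite ?subr_gt0 ?lerDl// !addr0.
  by rewrite !invfM !mulrA.
- move=> t tt; rewrite PR// SR// SL// PL//.
  by move: (dx u _) (dx u _) => p q; split; ring.
Qed.

(** Let [X] and [Y] be the integrals of the squared profiles that occur in the
    boundary integral, [EP] and [ES] those in the energy. By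
    [reflection_bound], [X <= EP + k2 * Y] and [Y <= ES + k1 * X] with
    [k1 * k2 < 1], so [X] and [Y] are at most [(EP + ES) / (1 - k1 * k2)]. All
    reflections are thus summed at once, and the constant depends neither on
    [T] nor on [L0]. *)
Lemma smooth_direct (u : R * R -> R) T : smooth_solution l1 l2 L0 u -> 0 <= T ->
  boundary_integral l1 l2 L0
    (fun t => dx u (- (l1 * t), t)) (fun t => dx u (l2 * t, t)) T <=
  (((1 + l1) ^+ 2 * (1 - l1))^-1 + ((1 + l2) ^+ 2 * (1 - l2))^-1) *
    (4 / (1 - (1 - l1) / (1 + l1) * ((1 - l2) / (1 + l2)))) *
  energy l1 l2 (dx u) (dt u) t0.
Proof.
move=> su T0; have [P [S [cP cS -> -> // rel]]] := smooth_identities u su.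
have t00 : 0 < t0 := start_gt0 _ _ _ hl hL.
have [/andP[l10 l11] /andP[l20 l21]] := (hl1, hl2).
have m1 : 0 < 1 - l1 by lra.
have m2 : 0 < 1 - l2 by lra.
have p1 : 0 < 1 + l1 by lra.
have p2 : 0 < 1 + l2 by lra.
have tT : t0 <= t0 + T by rewrite lerDl.
have k12 : (1 - l1) / (1 + l1) * ((1 - l2) / (1 + l2)) < 1.
  rewrite mulf_div ltr_pdivrMr ?mulr_gt0// mul1r -subr_gt0.
  have -> : (1 + l1) * (1 + l2) - (1 - l1) * (1 - l2) = 2 * (l1 + l2) by ring.
  by rewrite mulr_gt0.
set X := \int[mu]_(s in `[(1 - l1) * t0, (1 - l1) * (t0 + T)]) _.
set Y := \int[mu]_(s in `[(1 - l2) * t0, (1 - l2) * (t0 + T)]) _.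
set EP := \int[mu]_(s in `[(1 - l1) * t0, (1 + l2) * t0]) _.
set ES := \int[mu]_(s in `[(1 - l2) * t0, (1 + l1) * t0]) _.
set k1 := (1 - l1) / (1 + l1) in k12 *; set k2 := (1 - l2) / (1 + l2) in k12 *.
have sq0 (f : R -> R) x : 0 <= f x ^+ 2 by rewrite sqr_ge0.
have t0T : 0 <= t0 <= t0 + T by rewrite ltW.
have XY : X <= EP + k2 * Y.
  apply: reflection_bound => //; first by rewrite m1/=; lra.
  by move=> t /rel[].
have YX : Y <= ES + k1 * X.
  apply: reflection_bound => //; first by rewrite m2/=; lra.
  by move=> t /rel[].
have k10 : 0 < k1 by rewrite divr_gt0.
have k20 : 0 < k2 by rewrite divr_gt0.
have k11 : k1 <= 1 by rewrite ler_pdivrMr//; lra.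
have k21 : k2 <= 1 by rewrite ler_pdivrMr//; lra.
have EP0 : 0 <= EP by apply: Rintegral_ge0.
have ES0 : 0 <= ES by apply: Rintegral_ge0.
have c1 : 0 <= ((1 + l1) ^+ 2 * (1 - l1))^-1 by rewrite invr_ge0 mulr_ge0 ?sqr_ge0 ?ltW.
have c2 : 0 <= ((1 + l2) ^+ 2 * (1 - l2))^-1 by rewrite invr_ge0 mulr_ge0 ?sqr_ge0 ?ltW.
move: (_^-1) (_^-1) c1 c2 => c2 c1 c10 c20.
clearbody X Y EP ES k1 k2.
have kk : 0 < 1 - k1 * k2 by lra.
have X1 : X <= (EP + ES) / (1 - k1 * k2) by rewrite ler_pdivlMr//; nra.
have Y1 : Y <= (EP + ES) / (1 - k1 * k2) by rewrite ler_pdivlMr//; nra.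
apply: (@le_trans _ _ ((c1 + c2) * ((EP + ES) / (1 - k1 * k2)))).
  by rewrite [leRHS]mulrDl; apply: lerD; exact: ler_wpM2l.
rewrite le_eqVlt; apply/orP; left; apply/eqP.
have n : 1 - k1 * k2 != 0 by rewrite gt_eqF.
by field.
Qed.

(** After the time [T_tilde] the boundary has received every characteristic that
    starts in the initial interval: the intervals of integration of [P] and [S]
    in the boundary integral contain those in the energy. What remains is to
    compare the constants, where [(1 + k) ^+ 2 * (1 - k)] is
    [(1 - k ^+ 2) ^+ 2 / (1 - k)]. *)
Lemma smooth_observability (u : R * R -> R) T : smooth_solution l1 l2 L0 u ->
  T_tilde l1 l2 L0 <= T ->
  energy l1 l2 (dx u) (dt u) t0 <= obs_const l1 l2 * boundary_integral l1 l2 L0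
    (fun t => dx u (- (l1 * t), t)) (fun t => dx u (l2 * t, t)) T.
Proof.
move=> su; rewrite /T_tilde ge_max => /andP[T1 T2].
have t00 : 0 < t0 := start_gt0 _ _ _ hl hL.
have [/andP[l10 l11] /andP[l20 l21]] := (hl1, hl2).
have m1 : 0 < 1 - l1 by lra.
have m2 : 0 < 1 - l2 by lra.
have T0 : 0 <= T by apply: le_trans T1; rewrite divr_ge0 ?ltW.
have [P [S [cP cS -> -> // rel]]] := smooth_identities u su.
have cP2 := continuous_sqr _ cP; have cS2 := continuous_sqr _ cS.
set X := \int[mu]_(s in `[(1 - l1) * t0, (1 - l1) * (t0 + T)]) _.
set Y := \int[mu]_(s in `[(1 - l2) * t0, (1 - l2) * (t0 + T)]) _.
set EP := \int[mu]_(s in `[(1 - l1) * t0, (1 + l2) * t0]) _.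
set ES := \int[mu]_(s in `[(1 - l2) * t0, (1 + l1) * t0]) _.
have sq0 (f : R -> R) x : 0 <= f x ^+ 2 by rewrite sqr_ge0.
have LE : L0 = (l1 + l2) * t0 by rewrite /start mulrC divfK// gt_eqF.
have EX : EP <= X.
  apply: Rintegral_itv_sub => //; first by apply: ler_wpM2r; lra.
  by move: T1; rewrite ler_pdivrMr//; lra.
have EY : ES <= Y.
  apply: Rintegral_itv_sub => //; first by apply: ler_wpM2r; lra.
  by move: T2; rewrite ler_pdivrMr//; lra.
have EP0 : 0 <= EP by apply: Rintegral_ge0.
have ES0 : 0 <= ES by apply: Rintegral_ge0.
clearbody X Y EP ES.
(* the factor max(alpha, beta) of the constant only has to be at least 1 *)
have M1 : 1 <= Num.max (alpha l1 l2) (beta l1 l2).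
  by rewrite le_max /alpha ler_pdivlMr//; apply/orP; left; lra.
set M := Num.max _ _ in M1 *.
have key (k : R) : 0 <= k < 1 -> Num.min l1 l2 <= k <= Num.max l1 l2 ->
    4^-1 <= obs_const l1 l2 * ((1 + k) ^+ 2 * (1 - k))^-1.
  move=> /andP[k0 k1] /andP[km kM]; rewrite /obs_const -/M.
  have L1 : Num.max l1 l2 < 1 by rewrite gt_max l11.
  have m0 : 0 <= Num.min l1 l2 by rewrite le_min l10.
  set m := Num.min l1 l2 in km m0 *; set L := Num.max l1 l2 in kM L1 *.
  have D0 : 0 < (1 + k) ^+ 2 * (1 - k) by rewrite mulr_gt0 ?exprn_gt0//; lra.
  set D := (1 + k) ^+ 2 * (1 - k) in D0 *.
  rewrite ler_pdivlMr// ler_pdivlMr; last by rewrite mulr_gt0//; lra.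
  rewrite mulrACA mulVf// mul1r.
  have k2m : 0 <= 1 - k ^+ 2 <= 1 - m ^+ 2.
    by apply/andP; split; nra.
  apply: (@le_trans _ _ ((1 - k ^+ 2) ^+ 2)).
    have -> : (1 - k ^+ 2) ^+ 2 = D * (1 - k) by rewrite /D; ring.
    by rewrite ler_pM2l//; lra.
  move: k2m => /andP[k2 k2m].
  apply: (@le_trans _ _ ((1 - m ^+ 2) ^+ 2)); first by rewrite lerXn2r// nnegrE; lra.
  by rewrite ler_peMr// sqr_ge0.
have K1 : 4^-1 <= obs_const l1 l2 * ((1 + l1) ^+ 2 * (1 - l1))^-1.
  by apply: key; rewrite ?hl1// ge_min le_max !lexx.
have K2 : 4^-1 <= obs_const l1 l2 * ((1 + l2) ^+ 2 * (1 - l2))^-1.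
  by apply: key; rewrite ?hl2// ge_min le_max !lexx !orbT.
rewrite [leLHS]mulrDr [leRHS]mulrDr; apply: lerD; rewrite [leRHS]mulrA.
  apply: (@le_trans _ _ (4^-1 * X)); first by rewrite ler_wpM2l// invr_ge0.
  by apply: ler_wpM2r; [exact: (le_trans EP0 EX)|exact: K1].
apply: (@le_trans _ _ (4^-1 * Y)); first by rewrite ler_wpM2l// invr_ge0.
by apply: ler_wpM2r; [exact: (le_trans ES0 EY)|exact: K2].
Qed.

(** Both sides of the inequalities are integrals of squares, hence continuous
    for the [L2] limits that define the traces; estimates for smooth solutions
    therefore extend to all solutions. *)
Lemma boundary_traces_limit phi phix phit tl tr T :
  boundary_traces l1 l2 L0 phi phix phit tl tr -> 0 <= T ->
  exists u : nat -> R * R -> R, [/\ forall n, smooth_solution l1 l2 L0 (u n),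
    energy l1 l2 (dx (u n)) (dt (u n)) t0 @[n --> \oo] --> energy l1 l2 phix phit t0 &
    boundary_integral l1 l2 L0 (fun t => dx (u n) (- (l1 * t), t))
      (fun t => dx (u n) (l2 * t, t)) T @[n --> \oo] -->
    boundary_integral l1 l2 L0 tl tr T].
Proof.
move=> [u [su _ cx ct cb]] T0; have [cl cr] := cb T T0.
have split D f g : measurable D -> L2 D f -> L2 D g ->
    \int[mu]_(x in D) (f x ^+ 2 + g x ^+ 2) =
    \int[mu]_(x in D) (f x ^+ 2) + \int[mu]_(x in D) (g x ^+ 2).
  by move=> mD Lf Lg; rewrite RintegralD//; exact: L2_integrable_sqr.
have splitcvg D (f g : nat -> R -> R) F G : measurable D -> L2_cvg D f F -> L2_cvg D g G ->
    \int[mu]_(x in D) (f n x ^+ 2 + g n x ^+ 2) @[n --> \oo] -->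
    \int[mu]_(x in D) (F x ^+ 2 + G x ^+ 2).
  move=> mD cf cg; have [Lf LF _] := cf; have [Lg LG _] := cg.
  rewrite split//.
  rewrite (_ : (fun n => _) = (fun n => \int[mu]_(x in D) (f n x ^+ 2) +
     \int[mu]_(x in D) (g n x ^+ 2))); last by apply/funext => n; rewrite split.
  by apply: cvgD; exact: L2_cvg_int_sqr.
exists u; split=> //.
- apply: cvgM; first exact: cvg_cst.
  exact: (splitcvg _ _ _ _ _ (measurable_itv _) cx ct).
- exact: (splitcvg _ _ _ _ _ (measurable_itv _) cl cr).
Qed.

End fixed_L0.
End inequalities.

(** * C^1 functions that vanish at the end points belong to H^1_0 *)

Section H10_and_C1.
Context {R : realType}.
Local Notation mu := (@lebesgue_measure R).
Implicit Types (x y a b : R).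

(** Powers of the positive part are the source of all compactly supported
    functions below: the power [n.+2] is differentiable, with the power [n.+1]
    as its derivative up to a factor. *)
Definition pos_part x : R := Num.max 0 x.

Lemma pos_part_continuous : continuous pos_part.
Proof.
have -> : pos_part = fun x => (x + `|x|) / 2.
  apply/funext => x; rewrite /pos_part; case: (leP 0 x) => x0.
    by rewrite ger0_norm//; field.
  by rewrite ltr0_norm// subrr mul0r.
move=> x; apply: cvgM; last exact: cvg_cst.
by apply: cvgD; [exact: cvg_id|exact: norm_continuous].
Qed.

Lemma pos_partX_continuous n : continuous (fun x => pos_part x ^+ n).
Proof.
move=> x; apply: (@continuous_comp _ _ _ pos_part (fun y => y ^+ n)).
  exact: pos_part_continuous.
exact: exprn_continuous.
Qed.

Lemma is_derive_pos_partX n x :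
  is_derive x 1 (fun y => pos_part y ^+ n.+2) (n.+2%:R * pos_part x ^+ n.+1).
Proof.
have [x0|x0|->] := ltgtP x 0.
- have E : \forall y \near x, (fun y => pos_part y ^+ n.+2) y = cst 0 y.
    near=> y; rewrite /pos_part max_l ?expr0n//; apply/ltW; near: y.
    by apply: open_nbhs_nbhs; split; [exact: open_lt|].
  apply: (@near_eq_is_derive _ _ _ (cst 0) _ x 1 _ _).
    by apply: filterS E => y ->.
  apply: is_derive_eq.
  by rewrite /pos_part max_l ?ltW// expr0n mulr0.
- have E : \forall y \near x, (fun y => pos_part y ^+ n.+2) y = y ^+ n.+2.
    near=> y; rewrite /pos_part max_r//; apply/ltW; near: y.
    by apply: open_nbhs_nbhs; split; [exact: open_gt|].
  apply: (@near_eq_is_derive _ _ _ (fun y => y ^+ n.+2) _ x 1 _ _).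
    by apply: filterS E => y ->.
  have -> : (fun y : R => y ^+ n.+2) = id ^+ n.+2 by apply/funext => y; rewrite exprfctE.
  apply: is_derive_eq.
  by rewrite /pos_part max_r ?ltW// /GRing.scale/= mulr1.
(* at 0, the power n.+2 is the power n.+1 times the variable *)
- apply/is_derive1_caratheodory; exists (fun y => pos_part y ^+ n.+1); split.
  + move=> y; rewrite subr0 /pos_part maxxx expr0n subr0.
    case: (leP 0 y) => y0; first by rewrite -exprSr.
    by rewrite !expr0n mul0r.
  + exact: pos_partX_continuous.
  + by rewrite /pos_part maxxx !expr0n mulr0.
Unshelve. all: by end_near. Qed.

(** Squares of positive parts keep the step [C^1] while making it constant outside
    of [[1, 2]]. *)
Definition step y : R := 1 - pos_part (1 - pos_part (y - 1) ^+ 2) ^+ 2.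
Definition dstep y : R := 4 * pos_part (1 - pos_part (y - 1) ^+ 2) * pos_part (y - 1).

Lemma is_derive_step y : is_derive y 1 step (dstep y).
Proof.
have d1 : is_derive y 1 (fun z => z - 1) 1.
  by apply: is_derive_eq; rewrite oppr0 addr0.
have d2 := @is_derive1_comp _ _ (fun z => z - 1) y _ _ (is_derive_pos_partX 0 (y - 1)) d1.
have d3 := @is_deriveB _ _ _ _ _ _ _ _ _ (is_derive_cst (1 : R) y 1) d2.
have d4 := @is_derive1_comp _ _ _ y _ _ (is_derive_pos_partX 0 _) d3.
have d5 := @is_deriveB _ _ _ _ _ _ _ _ _ (is_derive_cst (1 : R) y 1) d4.
apply: is_derive_eq d5 _.
by rewrite /dstep /= /cst /= !expr1; ring.
Qed.

Lemma dstep_continuous : continuous dstep.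
Proof.
have c1 : continuous (fun y => pos_part (y - 1)).
  move=> y; apply: (@continuous_comp R R R (fun z => z - 1) pos_part).
    by apply: cvgB; [exact: cvg_id|exact: cvg_cst].
  exact: pos_part_continuous.
move=> y; apply: cvgM; last exact: c1.
apply: cvgM; first exact: cvg_cst.
apply: (@continuous_comp R R R (fun z => 1 - pos_part (z - 1) ^+ 2) pos_part).
  by apply: cvgB; [exact: cvg_cst|exact: (cvgM (c1 y) (c1 y))].
exact: pos_part_continuous.
Qed.

Lemma step_continuous : continuous step.
Proof.
move=> y; have [d _] := is_derive_step y.
by apply: differentiable_continuous; exact/derivable1_diffP.
Qed.

Lemma step_eq0 y : y <= 1 -> step y = 0.
Proof.
move=> y1; rewrite /step /pos_part (max_l (_ : y - 1 <= 0)); last by rewrite subr_le0.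
by rewrite expr0n subr0 max_r// expr1n subrr.
Qed.

Lemma step_eq1 y : 2 <= y -> step y = 1.
Proof.
move=> y2; rewrite /step /pos_part (max_r (_ : 0 <= y - 1)); last lra.
by rewrite max_l ?expr0n ?subr0//; nra.
Qed.

Lemma dstep_eq0 y : 2 <= y -> dstep y = 0.
Proof.
move=> y2; rewrite /dstep /pos_part (max_r (_ : 0 <= y - 1)); last lra.
by rewrite max_l ?mulr0 ?mul0r//; nra.
Qed.

Lemma step_bound y : `|step y| <= 1.
Proof.
rewrite /step.
have : 0 <= pos_part (1 - pos_part (y - 1) ^+ 2) <= 1.
  by rewrite /pos_part le_max lexx/= ge_max ler01/= gerBl sqr_ge0.
move: (pos_part _) => q /andP[q0 q1].
by rewrite ler_norml; apply/andP; split; nra.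
Qed.

Lemma dstep_bound y : `|dstep y| <= 4.
Proof.
have [y2|/ltW/dstep_eq0 ->] := leP y 2; last by rewrite normr0.
rewrite /dstep.
have : 0 <= pos_part (1 - pos_part (y - 1) ^+ 2) <= 1.
  by rewrite /pos_part le_max lexx/= ge_max ler01/= gerBl sqr_ge0.
have : 0 <= pos_part (y - 1) <= 1.
  by rewrite /pos_part le_max lexx/= ge_max ler01/=; lra.
move: (pos_part (y - 1)) => p /andP[p0 p1].
move: (pos_part _) => q /andP[q0 q1].
by rewrite ger0_norm ?mulr_ge0//; nra.
Qed.

Lemma continuous_bounded_itv (f : R -> R) a b : continuous f ->
  exists2 M, 0 < M & forall x, a <= x <= b -> `|f x| <= M.
Proof.
move=> cf.
have := @segment_compact _ a b => /(continuous_compact (continuous_subspaceT cf)).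
move=> /compact_bounded [M [_ H]].
exists (`|M| + 1); first by rewrite ltr_wpDl.
move=> x xab; apply: (H (`|M| + 1)).
  by rewrite (le_lt_trans (ler_norm _))// ltrDl.
by exists x => //=; rewrite in_itv.
Qed.

Lemma is_derive_continuous (f df : R -> R) :
  (forall x, is_derive x 1 f (df x)) -> continuous f.
Proof.
move=> d x; have [dx' _] := d x.
by apply: differentiable_continuous; exact/derivable1_diffP.
Qed.

Lemma is_derive_derive1 (f df : R -> R) :
  (forall x, is_derive x 1 f (df x)) -> derive1 f = df.
Proof. by move=> d; apply/funext => x; rewrite derive1E; case: (d x). Qed.

Section H10_of_C1.
Variables (v dv : R -> R) (a b : R).
Hypotheses (ab : a < b) (dvE : forall x, is_derive x 1 v (dv x)) (cdv : continuous dv).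
Hypotheses (va : v a = 0) (vb : v b = 0).

(** [vn n] is [v] cut off where the quadratic [rho], which vanishes at both end
    points, is below [n^-1]. *)
Let rho x := (x - a) * (b - x).
Let drho x := a + b - 2 * x.
Let vn (n : nat) x := step (n%:R * rho x) * v x.
Let dvn (n : nat) x := dstep (n%:R * rho x) * (n%:R * drho x) * v x +
   step (n%:R * rho x) * dv x.

Let cv : continuous v. Proof. exact: is_derive_continuous dvE. Qed.

Let drhoE (n : nat) x : is_derive x 1 (fun y => n%:R * rho y) (n%:R * drho x).
Proof.
apply: is_derive_eq; rewrite /GRing.scale/= /drho; ring.
Qed.

Let crho (n : nat) : continuous (fun y => n%:R * rho y).
Proof. exact: is_derive_continuous (drhoE n). Qed.

Let dvnE n x : is_derive x 1 (vn n) (dvn n x).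
Proof.
have d1 := @is_derive1_comp _ step (fun y => n%:R * rho y) x _ _ (is_derive_step _) (drhoE n x).
have d2 := @is_deriveM _ _ _ _ _ _ _ _ d1 (dvE x).
by apply: is_derive_eq d2 _; rewrite /dvn /GRing.scale/=; ring.
Qed.

Let cstepn n : continuous (fun y => step (n%:R * rho y)).
Proof.
move=> y; apply: (@continuous_comp R R R (fun y => n%:R * rho y) step).
  exact: crho.
exact: step_continuous.
Qed.

Let cdvn n : continuous (dvn n).
Proof.
move=> x; apply: cvgD.
  apply: cvgM; last exact: cv.
  apply: cvgM.
    apply: (@continuous_comp R R R (fun y => n%:R * rho y) dstep); first exact: crho.
    exact: dstep_continuous.
  apply: cvgM; first exact: cvg_cst.
  by apply: cvgB; [exact: cvg_cst|exact: mulrl_continuous].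
by apply: cvgM; [exact: cstepn|exact: cdv].
Qed.

(** [v] vanishes at least linearly at the end points. This makes the term
    [v * (n * drho * dstep)] of [dvn n] bounded: [dstep] is [0] unless
    [n * rho <= 2]. *)
Let v_rho : exists2 K, 0 < K & forall x, a <= x <= b -> `|v x| <= K * rho x.
Proof.
have [M M0 hM] := continuous_bounded_itv dv a b cdv.
have ba : 0 < b - a by rewrite subr_gt0.
exists (2 * M / (b - a)); first by rewrite divr_gt0// mulr_gt0.
move=> x /andP[ax xb].
(* the two bounds, each multiplied by the other factor, add up to one by [rho] *)
have h1 : `|v x| <= M * (x - a).
  have [|c cax E] := @MVT_segment _ v dv a x ax (fun y _ => dvE y).
    exact: continuous_subspaceT.
  move: E; rewrite va subr0 => ->; rewrite normrM [`|x - a|]ger0_norm ?subr_ge0//.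
  rewrite ler_wpM2r ?subr_ge0// hM//.
  by move: cax; rewrite in_itv/= => /andP[-> cx]; exact: le_trans xb.
have h2 : `|v x| <= M * (b - x).
  have [|c cax E] := @MVT_segment _ v dv x b xb (fun y _ => dvE y).
    exact: continuous_subspaceT.
  move: E; rewrite vb sub0r => E; rewrite -normrN E normrM [`|b - x|]ger0_norm ?subr_ge0//.
  rewrite ler_wpM2r ?subr_ge0// hM//.
  by move: cax; rewrite in_itv/= => /andP[cx ->]; rewrite (le_trans ax cx).
rewrite mulrAC ler_pdivlMr//.
have n0 := normr_ge0 (v x).
move: (`|v x|) h1 h2 n0 => q h1 h2 n0; rewrite /rho.
have e1 := ler_wpM2r (_ : 0 <= b - x) h1; have e2 := ler_wpM2r (_ : 0 <= x - a) h2.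
have := e1 (ltac:(lra)); have := e2 (ltac:(lra)); lra.
Qed.

Let step1 x : a < x < b -> \forall n \near \oo, 2 <= n%:R * rho x.
Proof.
move=> /andP[ax xb]; have r0 : 0 < rho x by rewrite mulr_gt0// subr_gt0.
near=> n; rewrite -ler_pdivrMr//.
by near: n; exact: nbhs_infty_ger.
Unshelve. all: by end_near. Qed.

Lemma C1c_cutoff n : C1c `]a, b[ (vn n).
Proof.
have ab' := ab.
pose K : set R := `[a, b]%classic `&` [set x : R | 1 <= n%:R * rho x].
have inK (x : R) : K x -> `]a, b[%classic x.
  move=> [/=]; rewrite !in_itv/= => /andP[ax xb] r1.
  have : rho x != 0 by apply: contraTneq r1 => ->; rewrite mulr0 -ltNge.
  rewrite mulf_eq0 !subr_eq0 negb_or => /andP[xa bx].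
  by rewrite !lt_neqAle ax xb eq_sym xa eq_sym bx.
have outK (x : R) : ~ K x -> vn n x = 0.
  move=> nK; rewrite /vn step_eq0 ?mul0r// leNgt; apply/negP => r1.
  apply: nK; split; last exact: ltW.
  rewrite /= in_itv/=; apply: contraTT r1 => nx; rewrite -leNgt.
  have r0 : rho x <= 0.
    move: nx; rewrite negb_and -!ltNge /rho => /orP[h|h].
      by rewrite mulr_le0_ge0//; lra.
    by rewrite mulr_ge0_le0//; lra.
  have h : n%:R * rho x <= 0 by rewrite mulr_ge0_le0.
  exact: le_trans h _.
split.
- by move=> x; case: (dvnE n x).
- by rewrite (is_derive_derive1 _ _ (dvnE n)); exact: cdvn.
exists K; split=> //.
apply: compact_closedI; first exact: segment_compact.
have h : closed ((fun x : R => n%:R * rho x) @^-1` [set y : R | 1 <= y]).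
  by apply: preimage_closed; [move=> x _; exact: crho|exact: closed_ge].
exact: h.
Qed.

(** The cut-off functions and their derivatives are bounded uniformly in [n] and
    are equal to [v] and [dv] at any given interior point from some [n] on, so
    they converge in [L2] by dominated convergence. *)
Lemma H10_of_C1 : H10_with `]a, b[ v dv.
Proof.
have sub : `]a, b[%classic `<=` `[a, b]%classic by exact: subset_itv_oo_cc.
have mI : measurable (`]a, b[%classic : set R) by exact: measurable_itv.
have mf (f : R -> R) : continuous f -> measurable_fun `]a, b[%classic f.
  by move=> cf; apply: measurable_funTS; exact: continuous_measurable_fun.
have cvn n : continuous (vn n) by exact: is_derive_continuous (dvnE n).
have [M M0 hM] := continuous_bounded_itv v a b cv.
have [M' M0' hM'] := continuous_bounded_itv dv a b cdv.
have [K K0 hK] := v_rho.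
split.
- exact: L2_continuous_fun sub cv.
- exact: L2_continuous_fun sub cdv.
- move=> w [dw cw _].
  have dwE x : is_derive x 1 w (derive1 w x).
    by apply: DeriveDef => //; rewrite derive1E.
  have cw' : continuous w := is_derive_continuous _ _ dwE.
  have c1 : continuous (fun x => v x * derive1 w x).
    by move=> x; apply: cvgM; [exact: cv|exact: cw].
  have c2 : continuous (fun x => dv x * w x).
    by move=> x; apply: cvgM; [exact: cdv|exact: cw'].
  rewrite !Rintegral_itv_oo_cc//.
  apply/eqP; rewrite -addr_eq0 -RintegralD//; first last.
  + exact: continuous_integrable.
  + exact: continuous_integrable.
  apply/eqP; apply: etrans (Rintegral_derive (fun x => v x * w x) _ a b (ltW ab) _ _) _.
  + by move=> x; apply: cvgD; [exact: c1|exact: c2].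
  + move=> x _; apply: is_derive_eq (@is_deriveM _ _ _ _ _ _ _ _ (dvE x) (dwE x)) _.
    by rewrite /GRing.scale/= [w x * _]mulrC.
  + by rewrite va vb !mul0r subrr.
- exists vn; split; first exact: C1c_cutoff.
  + apply: (L2_cvg_bounded _ _ _ a b M) => //.
    * by move=> n; apply: mf; exact: cvn.
    * exact: mf.
    * move=> n x /sub; rewrite /= in_itv/= => xab.
      by rewrite normrM -[M]mul1r ler_pM// ?step_bound ?hM.
    * by move=> x /sub; rewrite /= in_itv/= => xab; exact: hM.
    * move=> x; rewrite /= in_itv/= => xab; apply: cvg_near_cst.
      by apply: filterS (step1 x xab) => n h; rewrite /vn step_eq1 ?mul1r.
  + rewrite (_ : (fun n => _) = dvn); last first.
      by apply/funext => n; exact: is_derive_derive1 (dvnE n).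
    apply: (L2_cvg_bounded _ _ _ a b (8 * (b - a) * K + M')) => //.
    * by move=> n; apply: mf; exact: cdvn.
    * exact: mf.
    * move=> n x /sub; rewrite /= in_itv/= => xab.
      rewrite (le_trans (ler_normD _ _))// lerD//; last first.
        by rewrite normrM -[M']mul1r ler_pM// ?step_bound ?hM'.
      have [n2|/ltW/dstep_eq0 ->] := leP (n%:R * rho x) 2; last first.
        by rewrite !mul0r normr0 !mulr_ge0// ?subr_ge0 ltW.
      rewrite normrM [`|dstep _ * _|]normrM [`|_ * drho _|]normrM.
      have d0 : `|drho x| <= b - a.
        by move: xab => /andP[h1 h2]; rewrite /drho ler_norml; apply/andP; split; lra.
      have s0 := dstep_bound (n%:R * rho x).
      have v0 := hK x xab.
      have n0 : 0 <= n%:R :> R by [].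
      have r0 : 0 <= rho x by move: xab => /andP[h1 h2]; rewrite mulr_ge0 ?subr_ge0.
      rewrite (ger0_norm n0).
      have nv : n%:R * `|v x| <= 2 * K.
        apply: (@le_trans _ _ (n%:R * (K * rho x))); first exact: ler_wpM2l.
        by rewrite mulrCA [2 * K]mulrC ler_wpM2l// ltW.
      have -> : `|dstep (n%:R * rho x)| * (n%:R * `|drho x|) * `|v x| =
        `|dstep (n%:R * rho x)| * (`|drho x| * (n%:R * `|v x|)) by ring.
      have -> : 8 * (b - a) * K = 4 * ((b - a) * (2 * K)) by ring.
      by rewrite ler_pM// ?mulr_ge0// ler_pM// mulr_ge0.
    * move=> x /sub; rewrite /= in_itv/= => xab.
      by rewrite (le_trans (hM' x xab))// lerDr !mulr_ge0// ?subr_ge0 ltW.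
    * move=> x; rewrite /= in_itv/= => xab; apply: cvg_near_cst.
      apply: filterS (step1 x xab) => n h.
      by rewrite /dvn step_eq1// dstep_eq0// !mul0r add0r mul1r.
Qed.

End H10_of_C1.
End H10_and_C1.

(** * Weak derivatives of classical functions *)

Section weak_derivatives.
Context {R : realType}.
Local Notation mu := (@lebesgue_measure R).
Implicit Types (a b : R -> R) (u w f g : R * R -> R).

(** D'Alembert's form of a solution: [a] travels to the left, [b] to the right. *)
Definition travelling a b (z : R * R) : R := a (z.2 + z.1) + b (z.2 - z.1).

Lemma travelling_continuous a b : continuous a -> continuous b ->
  continuous (travelling a b).
Proof.
move=> ca cb z; apply: cvgD.
  apply: (@continuous_comp (R * R)%type R R (fun z => z.2 + z.1) a); last exact: ca.
  by apply: cvgD; [exact: cvg_snd|exact: cvg_fst].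
apply: (@continuous_comp (R * R)%type R R (fun z => z.2 - z.1) b); last exact: cb.
by apply: cvgB; [exact: cvg_snd|exact: cvg_fst].
Qed.

Lemma travelling_dx a b (da db : R -> R) : (forall s : R, is_derive s 1 a (da s)) ->
  (forall s : R, is_derive s 1 b (db s)) ->
  (forall z, derivable (travelling a b) z ((1, 0) : R * R)) /\
  dx (travelling a b) = travelling da (fun s => - db s).
Proof.
move=> dA dB.
have d (x t : R) : is_derive x 1 (fun y => travelling a b (y, t))
    (travelling da (fun s => - db s) (x, t)).
  have d1 := is_derive_affine a _ 1 t x (dA (1 * x + t)).
  have d2 := is_derive_affine b _ (- 1) t x (dB (- 1 * x + t)).
  have -> : (fun y => travelling a b (y, t)) =
      (fun y => a (1 * y + t)) \+ (fun y => b (- 1 * y + t)).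
    by apply/funext => y; rewrite /travelling /= mul1r mulN1r [y + t]addrC [- y + t]addrC.
  apply: is_derive_eq (@is_deriveD _ _ _ _ _ _ _ _ _ d1 d2) _.
  by rewrite /travelling /= !mul1r !mulN1r [x + t]addrC [- x + t]addrC.
by split=> [[x t]|]; [|apply/funext => -[x t]]; have [] := derivable_dx _ _ _ _ (d x t).
Qed.

Lemma travelling_dt a b (da db : R -> R) : (forall s : R, is_derive s 1 a (da s)) ->
  (forall s : R, is_derive s 1 b (db s)) ->
  (forall z, derivable (travelling a b) z ((0, 1) : R * R)) /\
  dt (travelling a b) = travelling da db.
Proof.
move=> dA dB.
have d (x t : R) : is_derive t 1 (fun s => travelling a b (x, s)) (travelling da db (x, t)).
  have d1 := is_derive_affine a _ 1 x t (dA (1 * t + x)).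
  have d2 := is_derive_affine b _ 1 (- x) t (dB (1 * t - x)).
  have -> : (fun s => travelling a b (x, s)) =
      (fun s => a (1 * s + x)) \+ (fun s => b (1 * s - x)).
    by apply/funext => s; rewrite /travelling /= !mul1r.
  apply: is_derive_eq (@is_deriveD _ _ _ _ _ _ _ _ _ d1 d2) _.
  by rewrite /travelling /= !mul1r.
by split=> [[x t]|]; [|apply/funext => -[x t]]; have [] := derivable_dt _ _ _ _ (d x t).
Qed.

Lemma travelling_C1 a b (da db : R -> R) : (forall s : R, is_derive s 1 a (da s)) ->
  (forall s : R, is_derive s 1 b (db s)) -> continuous da -> continuous db ->
  C1_on setT (travelling a b).
Proof.
move=> dA dB ca cb z _.
have [dx1 dxE] := travelling_dx _ _ _ _ dA dB.
have [dt1 dtE] := travelling_dt _ _ _ _ dA dB.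
split=> //; rewrite ?dxE ?dtE; apply: travelling_continuous => //.
by move=> s; apply: cvgN; exact: cb.
Qed.

Lemma C1_continuous w : C1_on setT w -> continuous w.
Proof.
move=> w1 [x t].
apply/cvgrPdist_le => e e0.
pose C := `|dx w (x, t)| + `|dt w (x, t)| + 2.
have C0 : 0 < C by rewrite ltr_wpDl.
have [d d0 hd] := C1_near_box setT w x t 1 openT w1 I ltr01.
have m0 : 0 < Num.min d (e / C) by rewrite lt_min d0 divr_gt0.
have := nbhsx_ballx (x, t) _ m0; apply: filterS => -[y s] [/= yx st].
have {}yx : `|y - x| < Num.min d (e / C) by rewrite distrC.
have {}st : `|s - t| < Num.min d (e / C) by rewrite distrC.
move: yx st; rewrite !lt_min => /andP[yd ye] /andP[sd se].
have [|c1 c1x E1] := MVT_between (fun y => w (y, s)) (fun y => dx w (y, s)) x y.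
  move=> y' _; apply: is_derive_dx; have [D _ _ _] := w1 (y', s) I; exact: D.
have [|c2 c2x E2] := MVT_between (fun s => w (x, s)) (fun s => dt w (x, s)) t s.
  move=> s' _; apply: is_derive_dt; have [_ D _ _] := w1 (x, s') I; exact: D.
have [_ b1 _] := hd c1 s (le_lt_trans c1x yd) sd.
have xx : `|x - x| < d by rewrite subrr normr0.
have [_ _ b2] := hd x c2 xx (le_lt_trans c2x sd).
rewrite distrC.
have -> : w (y, s) - w (x, t) = dx w (c1, s) * (y - x) + dt w (x, c2) * (s - t).
  by rewrite -E1 -E2 addrA subrK.
have n1 : `|dx w (c1, s)| <= `|dx w (x, t)| + 1.
  rewrite -lerBlDl; apply: le_trans (ltW b1); exact: lerB_dist.
have n2 : `|dt w (x, c2)| <= `|dt w (x, t)| + 1.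
  rewrite -lerBlDl; apply: le_trans (ltW b2); exact: lerB_dist.
rewrite (le_trans (ler_normD _ _))// !normrM.
apply: (@le_trans _ _ ((`|dx w (x, t)| + 1) * (e / C) + (`|dt w (x, t)| + 1) * (e / C))).
  by apply: lerD; apply: ler_pM; rewrite ?normr_ge0// ltW.
rewrite -mulrDl mulrA ler_pdivrMr// [leRHS]mulrC ler_wpM2r//; first exact: ltW.
by rewrite /C addrACA lerD2l -(natrD _ 1 1).
Qed.

Section test_functions.
Variables l1 l2 L0 : R.
Local Notation Q := (Q l1 l2 L0).
Local Notation integralQ := (integralQ l1 l2 L0).

(** For these functions the iterated integral over the domain [Q] with moving
    sides is an iterated integral over a fixed square, [integralQ_box]. *)
Definition CcQ f := continuous f /\ compact_support_in Q f.

Lemma CcQ_box f : CcQ f -> exists M0 : R, forall x t, f (x, t) != 0 ->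
  [/\ `|x| <= M0, `|t| <= M0 & Q (x, t)].
Proof.
move=> [_ [K [cK KQ f0]]].
have [M [_ /(_ (M + 1))]] := compact_bounded cK; rewrite ltrDl ltr01 => /(_ isT) h.
exists (M + 1) => x t fn.
have Kz : K (x, t) by apply: contrapT => /f0/eqP; rewrite (negbTE fn).
have /= := h _ Kz; rewrite prod_normE/= ge_max => /andP[h1 h2].
by split=> //; exact: KQ.
Qed.

Lemma CcQ_bounded f : CcQ f -> exists C : R, forall z, `|f z| <= C.
Proof.
move=> [cf [K [cK KQ f0]]].
have [M [_ /(_ (`|M| + 1)) h]] := compact_bounded (continuous_compact (continuous_subspaceT cf) cK).
have M1 : M < `|M| + 1 by rewrite (le_lt_trans (ler_norm _))// ltrDl.
exists (`|M| + 1) => z; have [Kz|nK] := pselect (K z).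
  by apply: (h M1); exists z.
by rewrite f0// normr0 addr_ge0.
Qed.

Lemma CcQB f g : CcQ f -> CcQ g -> CcQ (fun z => f z - g z).
Proof.
move=> [cf [K [cK KQ f0]]] [cg [K' [cK' KQ' g0]]]; split.
  by move=> z; apply: cvgB; [exact: cf|exact: cg].
exists (K `|` K'); split; first exact: compactU.
- by rewrite subUset; split.
- by move=> z nK; rewrite f0 ?g0 ?subrr// => ?; apply: nK; [right|left].
Qed.

Lemma slice_continuous f (t : R) : continuous f -> continuous (fun x => f (x, t)).
Proof.
move=> cf x; apply: (@cvg_comp _ _ _ (fun x => (x, t)) f _ _ _ _ (cf (x, t))).
by apply: cvg_pairR; [exact: cvg_id|exact: cvg_cst].
Qed.

Lemma time_slice_continuous f (x : R) : continuous f -> continuous (fun t => f (x, t)).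
Proof.
move=> cf t; apply: (@cvg_comp _ _ _ (fun t => (x, t)) f _ _ _ _ (cf (x, t))).
by apply: cvg_pairR; [exact: cvg_cst|exact: cvg_id].
Qed.

Lemma integral_slice_continuous f M : CcQ f ->
  continuous (fun t => \int[mu]_(x in `[- M, M]) f (x, t)).
Proof.
move=> fQ t; have [C fC] := CcQ_bounded _ fQ; have [cf _] := fQ.
have := @continuity_under_integral R _ _ mu (fun t x => f (x, t)) `[- M, M]%classic
  (measurable_itv _) (t - 1) (t + 1) _ _ (fun=> C) _ _ t; apply.
- by move=> s _; apply: continuous_integrable; exact: slice_continuous.
- by apply/aeW => x _ s _; exact: time_slice_continuous.
- by apply: continuous_integrable => x; exact: cvg_cst.
- by move=> s _; apply/aeW => x _; exact: fC.
- by rewrite inE/= in_itv/=; apply/andP; split; lra.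
Qed.

(** Outside [Q] the integrand is [0], so the sides of [I_ t] and the initial
    time can be replaced by those of any large square. *)
Lemma integralQ_box f : CcQ f -> exists M0, forall M, M0 <= M ->
  integralQ f = \int[mu]_(t in `[- M, M]) \int[mu]_(x in `[- M, M]) f (x, t).
Proof.
move=> fQ; have [M0 h] := CcQ_box _ fQ; exists M0 => M MM.
have out x t : (`|x| <= M -> `|t| <= M -> ~ Q (x, t)) -> f (x, t) = 0.
  move=> H; apply/eqP; apply: contrapT => /negP /h[h1 h2]; apply: H.
    exact: le_trans MM.
  exact: le_trans MM.
have outx x t : x \notin `[- M, M]%classic -> f (x, t) = 0.
  move=> nx; apply: out => xM _ _; move/negP: nx; apply.
  by rewrite inE/= in_itv/= -ler_norml.
have outt x t : t \notin `[- M, M]%classic -> f (x, t) = 0.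
  move=> nx; apply: out => _ xM _; move/negP: nx; apply.
  by rewrite inE/= in_itv/= -ler_norml.
rewrite /Defs.integralQ [LHS]Rintegral_mkcond [RHS]Rintegral_mkcond.
apply: eq_Rintegral => t _; rewrite /patch.
have inner : start l1 l2 L0 < t -> \int[mu]_(x in I_ l1 l2 t) f (x, t) =
    \int[mu]_(x in `[- M, M]) f (x, t).
  move=> tt; rewrite [LHS]Rintegral_mkcond [RHS]Rintegral_mkcond.
  apply: eq_Rintegral => x _; rewrite /patch.
  have -> : (if x \in I_ l1 l2 t then f (x, t) else 0) = f (x, t).
    case: ifPn => // /negP nI; apply/esym/out => _ _ [_ Ix]; apply: nI.
    by rewrite inE.
  by case: ifPn => // /outx ->.
case: ifPn => [|nt].
  rewrite inE/= in_itv/= andbT => tt; rewrite inner//.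
  case: ifPn => // nt; rewrite Rintegral_mkcond.
  rewrite (_ : _ \_ _ = fun=> 0); last first.
    by apply/funext => x; rewrite /patch; case: ifPn => // _; exact: outt.
  by rewrite /Rintegral integral0.
case: ifPn => // _; rewrite Rintegral_mkcond.
rewrite (_ : _ \_ _ = fun=> 0); first by rewrite /Rintegral integral0.
apply/funext => x; rewrite /patch; case: ifPn => // _; apply: out => _ _ [tt _].
by move/negP: nt; apply; rewrite inE/= in_itv/= andbT.
Qed.

Lemma integralQB f g : CcQ f -> CcQ g ->
  integralQ (fun z => f z - g z) = integralQ f - integralQ g.
Proof.
move=> fQ gQ; have [cf _] := fQ; have [cg _] := gQ.
have [M1 e1] := integralQ_box _ (CcQB _ _ fQ gQ).
have [M2 e2] := integralQ_box _ fQ; have [M3 e3] := integralQ_box _ gQ.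
pose M := Num.max M1 (Num.max M2 M3).
rewrite (e1 M) ?(e2 M) ?(e3 M) /M ?le_max ?lexx ?orbT//.
rewrite -RintegralB//; first last.
- exact: (continuous_integrable _ _ _ (integral_slice_continuous _ _ gQ)).
- exact: (continuous_integrable _ _ _ (integral_slice_continuous _ _ fQ)).
apply: eq_Rintegral => t _; rewrite RintegralB//.
- exact: (continuous_integrable _ _ _ (slice_continuous _ _ cf)).
- exact: (continuous_integrable _ _ _ (slice_continuous _ _ cg)).
Qed.

(** Off the closed support [w] is locally [0], hence so are its derivatives. *)
Lemma C1c2_CcQ w : C1c2 Q w -> [/\ CcQ w, CcQ (dx w) & CcQ (dt w)].
Proof.
move=> [w1 [K [cK KQ w0]]].
have cdx : continuous (dx w) by move=> z; have [_ _ c _] := w1 z I; exact: c.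
have cdt : continuous (dt w) by move=> z; have [_ _ _ c] := w1 z I; exact: c.
have oK : open (~` K).
  by apply: closed_openC; apply: compact_closed => //; exact: norm_hausdorff.
have near0 z : ~ K z -> \near z, w z = cst 0 z.
  move=> nK; have := open_nbhs_nbhs (conj oK nK).
  by apply: filterS => y /= /w0.
have cw := C1_continuous _ w1.
split.
- by split=> //; exists K.
- split=> //; exists K; split=> // z nK.
  by rewrite /dx (near_eq_derive _ (near0 z nK)) derive_cst.
- split=> //; exists K; split=> // z nK.
  by rewrite /dt (near_eq_derive _ (near0 z nK)) derive_cst.
Qed.

(** The inner integral is a difference of values of [w] on the sides of a square
    that is larger than the support. *)
Lemma integralQ_dx w : C1c2 Q w -> integralQ (dx w) = 0.
Proof.
move=> wQ; have [wc wx _] := C1c2_CcQ _ wQ; have [w1 _] := wQ.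
have [M1 h] := CcQ_box _ wc; have [M2 e] := integralQ_box _ wx.
(* large enough for [integralQ_box], and beyond the support of [w] *)
pose M := `|M1| + `|M2| + 1.
rewrite (e M); last by rewrite /M addrAC (le_trans (ler_norm _))// lerDr.
have M1M : M1 < M by rewrite /M (le_lt_trans (ler_norm _))// -addrA ltrDl ltr_wpDl.
have M0 : 0 <= M by rewrite /M !addr_ge0.
have [cw _] := wx.
have E t : \int[mu]_(x in `[- M, M]) dx w (x, t) = 0.
  apply: etrans (Rintegral_derive (fun x => w (x, t)) _ (- M) M _ _ _) _.
  - by rewrite (le_trans _ M0)// oppr_le0.
  - exact: slice_continuous.
  - by move=> x _; apply: is_derive_dx; have [D _ _ _] := w1 (x, t) I; exact: D.
  have out x : `|x| = M -> w (x, t) = 0.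
    move=> xM; apply/eqP; apply: contrapT => /negP /h[+ _ _].
    by rewrite xM leNgt M1M.
  by rewrite !out ?subrr// ?normrN ger0_norm.
under eq_Rintegral do rewrite E.
by rewrite /Rintegral integral0.
Qed.

(** Differentiation under the integral sign replaces an exchange of the order of
    integration: the outer integrand is the derivative of the integral of [w]
    over the section at time [t], which is [0] at both ends. *)
Lemma integralQ_dt w : C1c2 Q w -> integralQ (dt w) = 0.
Proof.
move=> wQ; have [wc _ wt] := C1c2_CcQ _ wQ; have [w1 _] := wQ.
have [M1 h] := CcQ_box _ wc; have [M2 e] := integralQ_box _ wt.
pose M := `|M1| + `|M2| + 1.
rewrite (e M); last by rewrite /M addrAC (le_trans (ler_norm _))// lerDr.
have M1M : M1 < M by rewrite /M (le_lt_trans (ler_norm _))// -addrA ltrDl ltr_wpDl.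
have M0 : 0 <= M by rewrite /M !addr_ge0.
have [cw _] := wc; have [cwt _] := wt.
pose J t := \int[mu]_(x in `[- M, M]) w (x, t).
have d (t x : R) : is_derive t 1 (fun s => w (x, s)) (dt w (x, t)).
  by apply: is_derive_dt; have [_ D _ _] := w1 (x, t) I; exact: D.
have p1 : partial1of2 (fun t x => w (x, t)) = (fun t x => dt w (x, t)).
  by apply/funext => t; apply/funext => x; rewrite partial1of2E; case: (d t x).
have [C wC] := CcQ_bounded _ wt.
have C0 : 0 <= C by apply: le_trans (wC (0, 0)).
have dJ (t : R) : is_derive t 1 J (\int[mu]_(x in `[- M, M]) dt w (x, t)).
  have It : `](t - 1), (t + 1)[%classic t by rewrite /= in_itv/=; apply/andP; split; lra.
  have i0 s : `](t - 1), (t + 1)[%classic s -> mu.-integrable `[- M, M] (EFin \o (fun x => w (x, s))).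
    by move=> _; apply: continuous_integrable; exact: slice_continuous.
  have i1 s x : `](t - 1), (t + 1)[%classic s -> `[- M, M]%classic x -> derivable (fun s => w (x, s)) s 1.
    by move=> _ _; case: (d s x).
  have i2 : mu.-integrable `[- M, M] (EFin \o (fun=> C)).
    by apply: continuous_integrable => x; exact: cvg_cst.
  have i3 s x : `](t - 1), (t + 1)[%classic s -> `[- M, M]%classic x ->
      `|partial1of2 (fun t x => w (x, t)) s x| <= C.
    by move=> _ _; rewrite p1; exact: wC.
  have D1 := @derivable_under_integral R _ _ mu (fun t x => w (x, t)) _
    (measurable_itv _) t _ _ It i0 i1 (fun=> C) (fun=> C0) i2 i3.
  have D2 := @differentiation_under_integral R _ _ mu (fun t x => w (x, t)) _
    (measurable_itv _) t _ _ It i0 i1 (fun=> C) (fun=> C0) i2 i3.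
  apply: DeriveDef; first exact: D1.
  rewrite p1 in D2; rewrite -derive1E; exact: D2.
apply: etrans (Rintegral_derive J _ (- M) M _ _ _) _.
- by rewrite (le_trans _ M0)// oppr_le0.
- exact: integral_slice_continuous.
have out t : `|t| = M -> J t = 0.
  move=> tM; rewrite /J (_ : (fun x => w (x, t)) = fun=> 0).
    by rewrite /Rintegral integral0.
  apply/funext => x; apply/eqP; apply: contrapT => /negP /h[_ + _].
  by rewrite tM leNgt M1M.
by rewrite !out ?subrr// ?normrN ger0_norm.
Qed.

Lemma C1c2M u w : C1_on setT u -> C1c2 Q w ->
  [/\ C1c2 Q (fun z => u z * w z),
      dx (fun z => u z * w z) = (fun z => dx u z * w z + u z * dx w z) &
      dt (fun z => u z * w z) = (fun z => dt u z * w z + u z * dt w z)].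
Proof.
move=> u1 wQ; have [wc wx wt] := C1c2_CcQ _ wQ; have [w1 _] := wQ.
have cu := C1_continuous _ u1; have [cw [K [cK KQ w0]]] := wc.
have Ex : dx (fun z => u z * w z) = (fun z => dx u z * w z + u z * dx w z).
  apply/funext => z; have [du _ _ _] := u1 z I; have [dw _ _ _] := w1 z I.
  by have := deriveM du dw; rewrite /GRing.scale/= addrC [w z * _]mulrC.
have Et : dt (fun z => u z * w z) = (fun z => dt u z * w z + u z * dt w z).
  apply/funext => z; have [_ du _ _] := u1 z I; have [_ dw _ _] := w1 z I.
  by have := deriveM du dw; rewrite /GRing.scale/= addrC [w z * _]mulrC.
split; [|exact: Ex|exact: Et].
split; last first.
  by exists K; split=> // z /w0 ->; rewrite mulr0.
move=> z _; have [du du' cdu cdu'] := u1 z I; have [dw dw' cdw cdw'] := w1 z I.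
split.
- exact: (derivableM du dw).
- exact: (derivableM du' dw').
- by rewrite Ex; exact: (cvgD (cvgM cdu (cw z)) (cvgM (cu z) cdw)).
- by rewrite Et; exact: (cvgD (cvgM cdu' (cw z)) (cvgM (cu z) cdw')).
Qed.

Lemma CcQM u f : continuous u -> CcQ f -> CcQ (fun z => u z * f z).
Proof.
move=> cu [cf [K [cK KQ f0]]]; split.
  by move=> z; apply: cvgM; [exact: cu|exact: cf].
by exists K; split=> // z /f0 ->; rewrite mulr0.
Qed.

Lemma weak_dt u w : C1_on setT u -> C1c2 Q w ->
  integralQ (fun z => u z * dt w z) = - integralQ (fun z => dt u z * w z).
Proof.
move=> u1 wQ; have [uwQ _ Et] := C1c2M _ _ u1 wQ.
have [wc _ _] := C1c2_CcQ _ wQ; have [_ _ uwc] := C1c2_CcQ _ uwQ.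
have cdu : continuous (dt u) by move=> z; have [_ _ _ c] := u1 z I; exact: c.
have -> : (fun z => u z * dt w z) = (fun z => dt (fun z => u z * w z) z - dt u z * w z).
  by apply/funext => z; rewrite Et addrAC subrr add0r.
by rewrite (integralQB _ _ uwc (CcQM _ _ cdu wc)) integralQ_dt// sub0r.
Qed.

Lemma weak_dx u w : C1_on setT u -> C1c2 Q w ->
  integralQ (fun z => u z * dx w z) = - integralQ (fun z => dx u z * w z).
Proof.
move=> u1 wQ; have [uwQ Ex _] := C1c2M _ _ u1 wQ.
have [wc _ _] := C1c2_CcQ _ wQ; have [_ uwc _] := C1c2_CcQ _ uwQ.
have cdu : continuous (dx u) by move=> z; have [_ _ c _] := u1 z I; exact: c.
have -> : (fun z => u z * dx w z) = (fun z => dx (fun z => u z * w z) z - dx u z * w z).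
  by apply/funext => z; rewrite Ex addrAC subrr add0r.
by rewrite (integralQB _ _ uwc (CcQM _ _ cdu wc)) integralQ_dx// sub0r.
Qed.

Lemma weak_wave (p q w : R * R -> R) : C1_on setT p -> C1_on setT q ->
  (forall z, dt p z = dx q z) -> C1c2 Q w ->
  integralQ (fun z => p z * dt w z - q z * dx w z) = 0.
Proof.
move=> p1 q1 pq wQ; have [_ wx wt] := C1c2_CcQ _ wQ.
have cp := C1_continuous _ p1; have cq := C1_continuous _ q1.
apply: (etrans (integralQB _ _ (CcQM _ _ cp wt) (CcQM _ _ cq wx))).
rewrite (weak_dt _ _ p1 wQ) (weak_dx _ _ q1 wQ).
rewrite (_ : (fun z => dt p z * w z) = (fun z => dx q z * w z)) ?subrr//.
by apply/funext => z; rewrite pq.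
Qed.

End test_functions.
End weak_derivatives.

(** * Travelling waves are solutions *)

Section travelling_waves.
Context {R : realType}.
Local Notation mu := (@lebesgue_measure R).
Variables l1 l2 L0 : R.
Hypotheses (hl1 : 0 <= l1 < 1) (hl2 : 0 <= l2 < 1) (hl : 0 < l1 + l2)
  (hL : 0 < L0).
Local Notation t0 := (start l1 l2 L0).
Local Notation I_ := (I_ l1 l2).

Lemma I_sub (M s : R) : `|s| <= M -> I_ s `<=` `[- M, M].
Proof.
have [/andP[l10 l11] /andP[l20 l21]] := (hl1, hl2).
move=> sM x; rewrite /I_ /= !in_itv/= => /andP[x1 x2].
have k (k' : R) : 0 <= k' < 1 -> `|k' * s| <= `|s|.
  by move=> /andP[k0 k1]; rewrite normrM ger0_norm// ler_piMl// ltW.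
have := k l1 hl1; have := k l2 hl2; rewrite !ler_norml => /andP[a1 a2] /andP[b1 b2].
by apply/andP; split; lra.
Qed.

(** Along a sequence of times tending to [t], the slices extended by [0] are
    bounded on a common interval and converge at every point except the two end
    points of [I_ t]; dominated convergence applies. *)
Lemma L2_continuous_travelling (F1 F2 : R -> R) : continuous F1 -> continuous F2 ->
  L2_continuous l1 l2 L0 (travelling F1 F2).
Proof.
move=> c1 c2 t tt; set f := travelling F1 F2.
have cf : continuous f by exact: travelling_continuous.
apply: cvg_within_filter.
have Lf s : L2 (I_ s) (slice f s).
  apply: (L2_continuous_fun _ _ (- `|s|) `|s|) => //; first exact: measurable_itv.
    exact: I_sub.
  exact: slice_continuous.
pose h s x := (slice f s \_ (I_ s)) x - (slice f t \_ (I_ t)) x.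
pose N s := Num.sqrt (\int[mu]_x (h s x ^+ 2)).
have NE s : L2_dist (slice f s \_ (I_ s)) (slice f t \_ (I_ t)) = (N s)%:E.
  by rewrite /L2_dist Lnorm2_sqrt//; apply: Lfun2B; exact: Lf.
rewrite (_ : (fun s => _) = (fun s => (N s)%:E)); last by apply/funext => s; exact: NE.
apply: cvg_EFin; first exact: nearW.
(* dominated convergence needs sequences of times *)
apply/(@cvg_nbhsP _ R^o) => w wt.
suff : Lnorm mu 2%:E (EFin \o h (w n)) @[n --> \oo] --> 0%E.
  rewrite (_ : (fun n => _) = (fun n => (N (w n))%:E)); first by move/fine_cvg.
  by apply/funext => n; rewrite -NE.
have [M' [_ M'w]] : bounded_fun w by apply: cvg_seq_bounded; apply/cvg_ex; exists t.
pose M0 := M' + 1.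
have M0w n : `|w n| <= M0 by apply: M'w => //; rewrite ltrDl.
pose M := Num.max M0 `|t|.
have wM n : `|w n| <= M by rewrite le_max M0w.
have tM : `|t| <= M by rewrite le_max lexx orbT.
have [C1 C10 hC1] := continuous_bounded_itv F1 (- (2 * M)) (2 * M) c1.
have [C2 C20 hC2] := continuous_bounded_itv F2 (- (2 * M)) (2 * M) c2.
have bnd s x : `|s| <= M -> `[- M, M]%classic x -> `|f (x, s)| <= C1 + C2.
  rewrite ler_norml /= in_itv/= => /andP[s1 s2] /andP[x1 x2].
  rewrite /f /travelling /= (le_trans (ler_normD _ _))// lerD//.
    by apply: hC1; apply/andP; split; lra.
  by apply: hC2; apply/andP; split; lra.
have bnd' s x : `|s| <= M -> `|(slice f s \_ (I_ s)) x| <= C1 + C2.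
  move=> sM; rewrite /patch; case: ifPn => [/set_mem Ix|_].
    by apply: bnd => //; exact: (I_sub M s sM).
  by rewrite normr0 addr_ge0// ltW.
have out s x : `|s| <= M -> ~ `[- M, M]%classic x -> (slice f s \_ (I_ s)) x = 0.
  move=> sM nx; rewrite /patch; case: ifPn => // /set_mem Ix.
  by case: nx; exact: (I_sub M s sM).
apply: (Lnorm2_cvg0 (fun n => h (w n)) (- M) M ((C1 + C2) + (C1 + C2))).
- move=> n; apply: measurable_funB.
    by have := Lf (w n); rewrite /L2 inE => /andP[/[!inE]].
  by have := Lf t; rewrite /L2 inE => /andP[/[!inE]].
- by move=> n x nx; rewrite /h !out// subrr.
- move=> n x; rewrite (le_trans (ler_normB _ _))// lerD// bnd'//.
exists ([set - (l1 * t)] `|` [set l2 * t]); split.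
- by apply: measurableU; exact: measurable_set1.
- rewrite measureU0; first exact: lebesgue_measure_set1.
  + exact: measurable_set1.
  + exact: measurable_set1.
  + exact: lebesgue_measure_set1.
move=> x /=; apply: contra_notP => /not_orP[n1 n2].
have cl : (fun n => - (l1 * w n)) @ \oo --> - (l1 * t).
  by apply: cvgN; apply: cvgM; [exact: cvg_cst|exact: wt].
have cr : (fun n => l2 * w n) @ \oo --> l2 * t.
  by apply: cvgM; [exact: cvg_cst|exact: wt].
have outcv : (\forall n \near \oo, ~ I_ (w n) x) -> ~ I_ t x -> h ^~ x \o w @ \oo --> (0 : R).
  move=> no nt; apply: cvg_near_cst; apply: filterS no => n no.
  by rewrite /= /h /patch !memNset// subrr.
have [x1|x1|/n1//] := ltgtP x (- (l1 * t)).
  apply: outcv.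
    apply: filterS (cvgr_gt _ cl _ x1) => n xn; rewrite /I_ /= in_itv/= => /andP[/lt_trans/(_ xn)].
    by rewrite ltxx.
  by rewrite /I_ /= in_itv/= => /andP[/lt_trans/(_ x1)]; rewrite ltxx.
have [x2|x2|/n2//] := ltgtP x (l2 * t); last first.
  apply: outcv.
    apply: filterS (cvgr_lt _ cr _ x2) => n xn; rewrite /I_ /= in_itv/= => /andP[_ /lt_trans/(_ xn)].
    by rewrite ltxx.
  by rewrite /I_ /= in_itv/= => /andP[_ /lt_trans/(_ x2)]; rewrite ltxx.
have It : I_ t x by rewrite /I_ /= in_itv/= x1.
have cfx : (fun n => f (x, w n) - f (x, t)) @ \oo --> (0 : R).
  apply/subr_cvg0; exact: (cvg_comp _ _ wt (time_slice_continuous f x cf t)).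
apply: cvg_trans cfx; apply: near_eq_cvg.
near=> n; rewrite /h /patch !mem_set// /I_ /= in_itv/=.
apply/andP; split.
  by near: n; exact: (cvgr_lt _ cl).
by near: n; exact: (cvgr_gt _ cr).
Unshelve. all: by end_near. Qed.

Section travelling_solution.
Variables (a b da db d2a d2b : R -> R).
Hypotheses (dA : forall s : R, is_derive s 1 a (da s))
  (dB : forall s : R, is_derive s 1 b (db s))
  (d2A : forall s : R, is_derive s 1 da (d2a s))
  (d2B : forall s : R, is_derive s 1 db (d2b s)).
Hypotheses (ca2 : continuous d2a) (cb2 : continuous d2b).
Hypothesis bcl : forall t, t0 <= t -> a ((1 - l1) * t) + b ((1 + l1) * t) = 0.
Hypothesis bcr : forall t, t0 <= t -> a ((1 + l2) * t) + b ((1 - l2) * t) = 0.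

Let u := travelling a b.
Let ndb s := - db s.
Let nd2b s := - d2b s.

Let ca : continuous a. Proof. exact: is_derive_continuous dA. Qed.
Let cb : continuous b. Proof. exact: is_derive_continuous dB. Qed.
Let cda : continuous da. Proof. exact: is_derive_continuous d2A. Qed.
Let cdb : continuous db. Proof. exact: is_derive_continuous d2B. Qed.
Let dN : forall s : R, is_derive s 1 ndb (nd2b s).
Proof. by move=> s; apply: is_deriveN. Qed.
Let cndb : continuous ndb. Proof. exact: is_derive_continuous dN. Qed.
Let cnd2b : continuous nd2b. Proof. by move=> s; apply: cvgN; exact: cb2. Qed.

Let uxE : dx u = travelling da ndb. Proof. exact: (travelling_dx _ _ _ _ dA dB).2. Qed.
Let utE : dt u = travelling da db. Proof. exact: (travelling_dt _ _ _ _ dA dB).2. Qed.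

Let u1 : C1_on setT u. Proof. exact: travelling_C1 dA dB cda cdb. Qed.
Let ux1 : C1_on setT (dx u). Proof. by rewrite uxE; exact: travelling_C1 d2A dN ca2 cnd2b. Qed.
Let ut1 : C1_on setT (dt u). Proof. by rewrite utE; exact: travelling_C1 d2A d2B ca2 cb2. Qed.

Let wave z : dt (dt u) z = dx (dx u) z.
Proof.
rewrite utE uxE (travelling_dt _ _ _ _ d2A d2B).2 (travelling_dx _ _ _ _ d2A dN).2.
by rewrite /travelling /nd2b opprK.
Qed.

Let uL t : t0 <= t -> u (- (l1 * t), t) = 0.
Proof.
move=> tt; rewrite /u /travelling /= -(bcl t tt) opprK.
by congr (a _ + b _); ring.
Qed.

Let uR t : t0 <= t -> u (l2 * t, t) = 0.
Proof.
move=> tt; rewrite /u /travelling /= -(bcr t tt).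
by congr (a _ + b _); ring.
Qed.

Lemma travelling_smooth : smooth_solution l1 l2 L0 u.
Proof.
split.
- by exists setT; split; [exact: openT| |split].
- by move=> z _; rewrite wave subrr.
- by move=> t /ltW tt; rewrite uL ?uR.
Qed.

Let sliceE z : derivable u z ((1, 0) : R * R). Proof. by have [] := u1 z I. Qed.

Lemma travelling_H10 t : t0 <= t -> H10_with (I_ t) (slice u t) (slice (dx u) t).
Proof.
move=> tt; have t00 : 0 < t0 by rewrite divr_gt0.
have t1 := lt_le_trans t00 tt.
have ll : - (l1 * t) < l2 * t by rewrite -subr_gt0 opprK -mulrDl addrC mulr_gt0.
apply: (H10_of_C1 _ _ _ _ ll).
- by move=> x; exact: is_derive_dx (sliceE (x, t)).
- by apply: slice_continuous; rewrite uxE; exact: travelling_continuous.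
- exact: uL.
- exact: uR.
Qed.

Lemma travelling_wave_solution :
  wave_solution l1 l2 L0 (slice u t0) (slice (dt u) t0) u (dx u) (dt u).
Proof.
have cut : continuous (dt u) by rewrite utE; exact: travelling_continuous.
split.
- exact: travelling_H10.
- move=> t _; apply: (L2_continuous_fun _ _ (- `|t|) `|t|) => //; first exact: measurable_itv.
    exact: I_sub.
  exact: slice_continuous.
- exact: L2_continuous_travelling.
- by rewrite uxE; exact: L2_continuous_travelling.
- by rewrite utE; exact: L2_continuous_travelling.
- by move=> psi pQ; exact: (weak_dt _ _ _ _ _ u1 pQ).
- by move=> psi pQ; exact: (weak_wave _ _ _ _ _ _ ut1 ux1 wave pQ).
- exact/aeW.
- exact/aeW.
Qed.

(** A smooth solution is its own approximating sequence. *)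
Lemma travelling_traces : boundary_traces l1 l2 L0 u (dx u) (dt u)
  (fun t => dx u (- (l1 * t), t)) (fun t => dx u (l2 * t, t)).
Proof.
have cu : continuous u by exact: travelling_continuous.
have cux : continuous (dx u) by rewrite uxE; exact: travelling_continuous.
have cut : continuous (dt u) by rewrite utE; exact: travelling_continuous.
have LI f : continuous f -> L2 (I_ t0) (slice f t0).
  move=> cf; apply: (L2_continuous_fun _ _ (- `|t0|) `|t0|); first exact: measurable_itv.
    exact: I_sub.
  exact: slice_continuous.
have Lline k T : L2 `[t0, t0 + T] (fun t => dx u (k * t, t)).
  apply: (L2_continuous_fun _ _ t0 (t0 + T)) => //.
  move=> t; apply: (@cvg_comp _ _ _ (fun t => (k * t, t)) (dx u) _ _ _ _ (cux (k * t, t))).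
  by apply: cvg_pairR; [exact: mulrl_continuous|exact: cvg_id].
exists (fun=> u); split.
- by move=> _; exact: travelling_smooth.
- by apply: L2_cvg_cst; exact: LI.
- by apply: L2_cvg_cst; exact: LI.
- by apply: L2_cvg_cst; exact: LI.
- move=> T T0; split; last by apply: L2_cvg_cst; exact: Lline.
  have -> : (fun t => dx u (- (l1 * t), t)) = (fun t => dx u (- l1 * t, t)).
    by apply/funext => t; rewrite mulNr.
  by apply: L2_cvg_cst; exact: Lline.
Qed.

(** The integrand of the energy is [2 * (da ^+ 2 + db ^+ 2)], continuous and
    positive at [x1]. *)
Lemma travelling_energy_gt0 (x1 : R) : I_ t0 x1 -> da (t0 + x1) != 0 \/ db (t0 - x1) != 0 ->
  0 < energy l1 l2 (dx u) (dt u) t0.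
Proof.
rewrite /I_ /= in_itv/= => /andP[xl xr] nz.
pose F x := dx u (x, t0) ^+ 2 + dt u (x, t0) ^+ 2.
have cux : continuous (dx u) by rewrite uxE; exact: travelling_continuous.
have cut : continuous (dt u) by rewrite utE; exact: travelling_continuous.
have cF : continuous F.
  move=> x; have cx := slice_continuous _ t0 cux x; have ct := slice_continuous _ t0 cut x.
  exact: (cvgD (cvgM cx cx) (cvgM ct ct)).
have F0 x : 0 <= F x by rewrite addr_ge0// sqr_ge0.
have Fx1 : 0 < F x1.
  rewrite /F uxE utE /travelling /ndb /=.
  have -> : (da (t0 + x1) + - db (t0 - x1)) ^+ 2 + (da (t0 + x1) + db (t0 - x1)) ^+ 2 =
    2 * (da (t0 + x1) ^+ 2 + db (t0 - x1) ^+ 2) by ring.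
  by rewrite mulr_gt0//; case: nz => nz; [rewrite ltr_wpDr|rewrite ltr_wpDl];
    rewrite ?sqr_ge0// lt_neqAle sqr_ge0 eq_sym sqrf_eq0 nz.
have e0 : 0 < F x1 / 2 by rewrite divr_gt0.
have /cvgrPdist_lt/(_ _ e0) := cF x1.
move=> /nbhs_ballP[d /= d0 hd].
pose c := Num.max (- (l1 * t0)) (x1 - d / 2); pose e := Num.min (l2 * t0) (x1 + d / 2).
have cx : c < x1 by rewrite gt_max xl/= ltrBlDr ltrDl divr_gt0.
have xe : x1 < e by rewrite lt_min xr/= ltrDl divr_gt0.
have cF2 : continuous (fun _ : R => F x1 / 2) by move=> y; exact: cvg_cst.
rewrite /energy mulr_gt0 ?invr_gt0// /Defs.I_ (Rintegral_itv_oo_cc F)//.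
apply: (@lt_le_trans _ _ (\int[mu]_(x in `[c, e]) F x)); last first.
  apply: Rintegral_itv_sub => //.
  - by rewrite le_max lexx.
  - by rewrite ltW// (lt_trans cx).
  - by rewrite ge_min lexx.
apply: (@lt_le_trans _ _ (\int[mu]_(x in `[c, e]) (F x1 / 2))).
  rewrite Rintegral_cst//.
  rewrite mulr_gt0//= lebesgue_measure_itv/= lte_fin (lt_trans cx xe) /=.
  by rewrite subr_gt0 (lt_trans cx xe).
apply: le_Rintegral => //.
- exact: continuous_integrable.
- exact: continuous_integrable.
move=> x /=; rewrite in_itv/= => /andP[cx' xe'].
have : `|F x1 - F x| < F x1 / 2.
  apply: hd; rewrite /ball/=.
  move: cx' xe'; rewrite /c /e ge_max le_min => /andP[_ h1] /andP[_ h2].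
  by rewrite ltr_norml; apply/andP; split; lra.
by rewrite ltr_norml => /andP[_]; lra.
Qed.

End travelling_solution.
End travelling_waves.

(** * A log-periodic bump *)

Section log_periodic.
Context {R : realType}.
Implicit Types (s y c lo : R).

(** Cutting [F] to [0] on the left of [lo] is smooth as soon as [F] is [0] on a
    whole interval [(lo, b]]. *)
Definition glue lo (F : R -> R) s : R := if s <= lo then 0 else F s.

Section glue.
Variables (lo b : R).
Hypothesis lob : lo < b.

Lemma glue_eq0 (F : R -> R) s : (forall s, lo < s -> s <= b -> F s = 0) ->
  s <= b -> glue lo F s = 0.
Proof. by move=> F0 sb; rewrite /glue; case: ifPn => //; rewrite -ltNge => /F0; apply. Qed.

Lemma glue_near (F : R -> R) s : (forall s, lo < s -> s <= b -> F s = 0) ->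
  (s < b /\ \near s, cst 0 s = glue lo F s) \/ (lo < s /\ \near s, F s = glue lo F s).
Proof.
move=> F0; have [sb|bs] := ltP s b.
  left; split=> //; near=> y; rewrite /= glue_eq0//; apply/ltW; near: y.
  by apply: open_nbhs_nbhs; split; [exact: open_lt|].
right; have los : lo < s by exact: lt_le_trans bs.
split=> //; near=> y; rewrite /glue leNgt (_ : lo < y)//; near: y.
by apply: open_nbhs_nbhs; split; [exact: open_gt|].
Unshelve. all: by end_near. Qed.

Lemma is_derive_glue (F dF : R -> R) : (forall s, lo < s -> is_derive s 1 F (dF s)) ->
  (forall s, lo < s -> s <= b -> F s = 0) -> (forall s, lo < s -> s <= b -> dF s = 0) ->
  forall s, is_derive s 1 (glue lo F) (glue lo dF s).
Proof.
move=> FdF F0 dF0 s; have [[sb n0]|[los nF]] := glue_near F s F0.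
  rewrite (glue_eq0 dF)// ?ltW//; apply: near_eq_is_derive n0 _.
apply: near_eq_is_derive nF _; rewrite /glue leNgt los/=.
exact: FdF.
Qed.

Lemma glue_continuous (F : R -> R) : (forall s, lo < s -> {for s, continuous F}) ->
  (forall s, lo < s -> s <= b -> F s = 0) -> continuous (glue lo F).
Proof.
move=> cF F0 s; have [[sb n0]|[los nF]] := glue_near F s F0.
  rewrite /continuous_at (glue_eq0 F)// ?ltW//.
  by apply: cvg_near_cst; apply: filterS n0 => y <-.
have E : glue lo F s = F s by rewrite /glue leNgt los.
rewrite /continuous_at E.
apply: cvg_trans (cF s los); apply: near_eq_cvg; exact: nF.
Qed.

End glue.

(** A [C^2] function of period [2 pi], supported where the cosine exceeds [c]. *)
Definition cosbump c y : R := pos_part (cos y - c) ^+ 3.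
Definition dcosbump c y : R := - (3 * pos_part (cos y - c) ^+ 2 * sin y).
Definition d2cosbump c y : R := 6 * pos_part (cos y - c) * sin y ^+ 2 -
  3 * pos_part (cos y - c) ^+ 2 * cos y.

Lemma is_derive_cos_sub c y : is_derive y 1 (fun z => cos z - c) (- sin y).
Proof. by apply: is_derive_eq; rewrite oppr0 addr0. Qed.

Lemma is_derive_cosbump c y : is_derive y 1 (cosbump c) (dcosbump c y).
Proof.
have d := @is_derive1_comp _ _ (fun z => cos z - c) y _ _ (is_derive_pos_partX 1 _) (is_derive_cos_sub c y).
by apply: is_derive_eq d _; rewrite /dcosbump mulrN.
Qed.

Lemma is_derive_dcosbump c y : is_derive y 1 (dcosbump c) (d2cosbump c y).
Proof.
have d := @is_derive1_comp _ _ (fun z => cos z - c) y _ _ (is_derive_pos_partX 0 _) (is_derive_cos_sub c y).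
have d1 := @is_deriveM _ _ _ _ _ _ _ _ d (is_derive_sin y).
have -> : dcosbump c = fun z => - 3 * (pos_part (cos z - c) ^+ 2 * sin z).
  by apply/funext => z; rewrite /dcosbump; ring.
apply: is_derive_eq (@is_deriveZ _ _ _ _ (- 3) _ _ _ d1) _.
by rewrite /d2cosbump /GRing.scale/= expr1; ring.
Qed.

Lemma pos_part_cos_continuous c : continuous (fun y => pos_part (cos y - c)).
Proof.
move=> y; apply: (@continuous_comp R R R (fun z => cos z - c) pos_part).
  by apply: cvgB; [exact: continuous_cos|exact: cvg_cst].
exact: pos_part_continuous.
Qed.

Lemma d2cosbump_continuous c : continuous (d2cosbump c).
Proof.
move=> y; have cp := pos_part_cos_continuous c y.
have cs : {for y, continuous (@sin R)} by exact: continuous_sin.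
have cc : {for y, continuous (@cos R)} by exact: continuous_cos.
apply: cvgB.
  by apply: cvgM; [apply: cvgM; [exact: cvg_cst|exact: cp]|exact: (cvgM cs cs)].
by apply: cvgM; [apply: cvgM; [exact: cvg_cst|exact: (cvgM cp cp)]|exact: cc].
Qed.

Lemma cosbump_eq0 c y : cos y <= c ->
  [/\ cosbump c y = 0, dcosbump c y = 0 & d2cosbump c y = 0].
Proof.
move=> yc; rewrite /cosbump /dcosbump /d2cosbump /pos_part max_l ?subr_le0//.
by split; ring.
Qed.

Lemma cos_le_outside y c : 0 <= c <= pi -> c <= y <= pi *+ 2 - c -> cos y <= cos c.
Proof.
move=> /andP[c0 cpi] /andP[cy yc].
have main z : c <= z -> z <= pi -> cos z <= cos c.
  rewrite le_eqVlt => /orP[/eqP->//|cz zpi]; apply/ltW; rewrite ltr_cos// in_itv/=.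
    by rewrite c0.
  by rewrite zpi (le_trans c0 (ltW cz)).
have [ypi|piy] := leP y pi; first exact: main.
have -> : cos y = cos (pi *+ 2 - y) by rewrite -cosN -[LHS]cosD2pi; congr cos; ring.
move: yc; rewrite mulr2n => yc; apply: main; lra.
Qed.

Section log_bump.
Variables (w y0 c : R).

Let th s := w * (ln s - y0).
Definition logbump s : R := cosbump c (th s).
Definition dlogbump s : R := dcosbump c (th s) * (w / s).
Definition d2logbump s : R := d2cosbump c (th s) * (w / s) ^+ 2 - dcosbump c (th s) * (w / s ^+ 2).

Let dth s : 0 < s -> is_derive s 1 th (w / s).
Proof.
move=> s0; have d := @is_deriveB _ _ _ _ _ _ _ _ _ (is_derive1_ln s0) (is_derive_cst y0 s 1).
by apply: is_derive_eq (@is_deriveZ _ _ _ _ w _ _ _ d) _; rewrite subr0.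
Qed.

Lemma is_derive_logbump s : 0 < s -> is_derive s 1 logbump (dlogbump s).
Proof.
by move=> s0; exact: (@is_derive1_comp _ (cosbump c) th s _ _ (is_derive_cosbump _ _) (dth s s0)).
Qed.

Lemma is_derive_dlogbump s : 0 < s -> is_derive s 1 dlogbump (d2logbump s).
Proof.
move=> s0.
have d1 := @is_derive1_comp _ (dcosbump c) th s _ _ (is_derive_dcosbump _ _) (dth s s0).
have s1 : s != 0 by rewrite gt_eqF.
have d2 := @is_deriveZ _ _ _ _ w _ _ _ (@is_deriveV _ id s _ 1 s1 (is_derive_id _ _)).
apply: is_derive_eq (@is_deriveM _ _ _ _ _ _ _ _ d1 d2) _.
rewrite /d2logbump /GRing.scale/=.
rewrite (_ : w *: s^-1 = w * s^-1)//.
move: (dcosbump _ _) (d2cosbump _ _) => p q; field; exact: s1.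
Qed.

Lemma d2logbump_continuous s : 0 < s -> {for s, continuous d2logbump}.
Proof.
move=> s0; have s1 : s != 0 by rewrite gt_eqF.
have ct : th @ s --> th s.
  by have [d _] := dth s s0; apply: differentiable_continuous; exact/derivable1_diffP.
have cs : (fun s => w / s) @ s --> w / s.
  by apply: cvgM; [exact: cvg_cst|apply: cvgV => //; exact: cvg_id].
have cs2 : (fun s => w / s ^+ 2) @ s --> w / s ^+ 2.
  apply: cvgM; [exact: cvg_cst|apply: cvgV; first by rewrite expf_neq0].
  exact: exprn_continuous.
have c1 : continuous (dcosbump c) := is_derive_continuous _ _ (is_derive_dcosbump c).
apply: cvgB.
  apply: cvgM; last exact: (cvgM cs cs).
  exact: (cvg_comp _ _ ct (d2cosbump_continuous c (th s))).
by apply: cvgM; [exact: (cvg_comp _ _ ct (c1 (th s)))|exact: cs2].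
Qed.

End log_bump.

(** [G] is a bump in the variable [ln s], repeated with period [ln g]. One copy
    of the support is [[b, d]]; the interval [[d / g, b]] that separates it from
    the preceding copy is where the function is cut to [0], so that it is
    defined and [C^2] on R. *)
Lemma log_periodic_bump (g b d : R) : 1 < g -> 0 < d -> d / g < b -> b < d ->
  exists G G1 G2 : R -> R,
    [/\ forall s, is_derive s 1 G (G1 s), forall s, is_derive s 1 G1 (G2 s),
        continuous G2,
        (forall s, s <= b -> G s = 0 /\ G1 s = 0) /\ (forall s, d / g <= s -> G (g * s) = G s) &
        exists2 m, b < m < d & G m != 0].
Proof.
move=> g1 d0 dgb bd.
have g0 : 0 < g by exact: lt_trans g1.
have lo0 : 0 < d / g by rewrite divr_gt0.
have b0 : 0 < b by exact: lt_trans dgb.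
have pos (x : R) : 0 < x -> x \is Num.pos by rewrite posrE.
pose P := ln g; have P0 : 0 < P by exact: ln_gt0.
(* [w] turns the period [P] into [2 pi] *)
pose w : R := pi *+ 2 / P.
have w0 : 0 < w by rewrite divr_gt0// mulrn_wgt0// pi_gt0.
have wP : w * P = pi *+ 2 by rewrite /w divfK ?gt_eqF.
(* centre and half-width of the bump in the variable [ln s] *)
pose y0 := (ln b + ln d) / 2; pose dl := (ln d - ln b) / 2.
have lbd : ln b < ln d by rewrite ltr_ln ?pos.
have dl0 : 0 < dl by rewrite /dl divr_gt0// subr_gt0.
have lnlo : ln (d / g) = ln d - P by rewrite ln_div ?pos.
have dlP : dl *+ 2 < P.
  rewrite (_ : dl *+ 2 = ln d - ln b); last by rewrite /dl; field.
  by rewrite ltrBlDl -ltrBlDr -lnlo ltr_ln ?pos.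
have wdl0 : 0 < w * dl by rewrite mulr_gt0.
have wdlpi : w * dl < pi.
  by have := dlP; rewrite -(ltr_pM2l w0) wP mulrnAr ltrMn2r.
pose c := cos (w * dl).
have zero s : d / g <= s -> s <= b -> cos (w * (ln s - y0)) <= c.
  move=> ls sb; have s0 : 0 < s by exact: lt_le_trans ls.
  have h1 : ln s <= ln b by rewrite ler_ln ?pos.
  have h2 : ln d - P <= ln s by rewrite -lnlo ler_ln ?pos.
  rewrite -cosN; apply: cos_le_outside; first by rewrite !ltW.
  have -> : - (w * (ln s - y0)) = w * (y0 - ln s) by ring.
  rewrite -wP -mulrBr !ler_pM2l//; apply/andP; split; rewrite /y0 /dl; lra.
pose lo := d / g.
have z0 s : lo < s -> s <= b -> logbump w y0 c s = 0.
  by move=> /ltW /zero h /h; case/cosbump_eq0.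
have z1 s : lo < s -> s <= b -> dlogbump w y0 c s = 0.
  by move=> /ltW /zero h /h; case/cosbump_eq0 => _ e _; rewrite /dlogbump e mul0r.
have z2 s : lo < s -> s <= b -> d2logbump w y0 c s = 0.
  move=> /ltW /zero h /h; case/cosbump_eq0 => _ e e'.
  by rewrite /d2logbump e e' !mul0r subrr.
have gt0 s : lo < s -> 0 < s by exact: lt_trans.
exists (glue lo (logbump w y0 c)), (glue lo (dlogbump w y0 c)), (glue lo (d2logbump w y0 c)).
split.
- exact: (is_derive_glue lo b dgb _ _ (fun s h => is_derive_logbump _ _ _ s (gt0 s h)) z0 z1).
- exact: (is_derive_glue lo b dgb _ _ (fun s h => is_derive_dlogbump _ _ _ s (gt0 s h)) z1 z2).
- apply: (glue_continuous lo b dgb) => // s /gt0 s0; exact: d2logbump_continuous.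
- split=> [s sb|s]; first by rewrite (glue_eq0 _ _ _ _ z0 sb) (glue_eq0 _ _ _ _ z1 sb).
  have los : lo < d by exact: lt_trans bd.
  rewrite le_eqVlt => /orP[/eqP <-|ls].
    rewrite mulrC divfK ?gt_eqF// /glue lexx leNgt los/=.
    have cd : cos (w * (ln d - y0)) <= c.
      by rewrite /c (_ : ln d - y0 = dl)// /y0 /dl; field.
    by have [e _ _] := cosbump_eq0 c _ cd.
  have s0 := gt0 _ ls.
  have lgs : lo < g * s by apply: lt_trans ls _; rewrite ltr_pMl.
  rewrite /glue !leNgt lgs (_ : lo < s)//= /logbump /cosbump lnM ?pos//.
  have -> : w * (ln g + ln s - y0) = w * (ln s - y0) + pi *+ 2 by rewrite -wP /P; ring.
  by rewrite cosD2pi.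
- have ly : ln b < y0 by rewrite /y0; lra.
  have yl : y0 < ln d by rewrite /y0; lra.
  have my : b < expR y0 by rewrite -{1}(lnK (pos b b0)) ltr_expR.
  have ym : expR y0 < d by rewrite -{1}(lnK (pos d d0)) ltr_expR.
  exists (expR y0); first by rewrite my.
  have lom : lo < expR y0 by exact: lt_trans my.
  rewrite /glue leNgt lom /= /logbump expRK subrr mulr0 /cosbump cos0 expf_neq0//.
  have c1 : c < 1 by rewrite /c -cos0 ltr_cos// in_itv/= ?lexx ?pi_ge0 ?(ltW wdl0) ?(ltW wdlpi).
  by rewrite /pos_part max_r ?gt_eqF ?subr_gt0// subr_ge0 ltW.
Qed.

End log_periodic.

(** * Solutions without traces up to a given time *)

Section silent_waves.
Context {R : realType}.

(** The profile [f] is a bump carried by the part of the initial interval whose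
    characteristics have not yet reached the boundary [x = k2 t] at time
    [t0 + T]; such a part exists because [T] is short. The condition at
    [x = k2 t] forces [h s = - f (k * s)], and the condition at [x = - k1 t] then
    says that [f] is invariant under multiplication by [g], the factor gained
    in two reflections. *)
Lemma silent_profile (k1 k2 t0 T : R) : 0 <= k1 < 1 -> 0 <= k2 < 1 -> 0 < k1 + k2 ->
  0 < t0 -> 0 <= T -> (1 - k2) * T < (k1 + k2) * t0 ->
  exists f df d2f h dh d2h : R -> R,
    [/\ [/\ forall s : R, is_derive s 1 f (df s), forall s : R, is_derive s 1 df (d2f s) &
            continuous d2f],
        [/\ forall s : R, is_derive s 1 h (dh s), forall s : R, is_derive s 1 dh (d2h s) &
            continuous d2h],
        (forall t, t0 <= t -> h ((1 - k1) * t) + f ((1 + k1) * t) = 0 /\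
                              h ((1 + k2) * t) + f ((1 - k2) * t) = 0),
        (forall t, t0 <= t <= t0 + T -> dh ((1 - k1) * t) = 0 /\ df ((1 - k2) * t) = 0) &
        exists2 c, (1 - k2) * t0 < c < (1 + k1) * t0 & df c != 0].
Proof.
move=> /andP[k10 k11] /andP[k20 k21] k12 t00 T0 hT.
have m1 : 0 < 1 - k1 by lra.
have m2 : 0 < 1 - k2 by lra.
have p1 : 0 < 1 + k1 by lra.
have p2 : 0 < 1 + k2 by lra.
have n1 := lt0r_neq0 m1; have n2 := lt0r_neq0 m2.
have n3 := lt0r_neq0 p1; have n4 := lt0r_neq0 p2.
pose g := (1 + k1) * (1 + k2) / ((1 - k1) * (1 - k2)).
pose k : R := (1 - k2) / (1 + k2).
(* characteristics with parameter below [b] have reached the boundary at time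
   [t0 + T]; [d] is the end of the initial interval *)
pose b : R := (1 - k2) * (t0 + T); pose d : R := (1 + k1) * t0.
have g1 : 1 < g.
  rewrite /g ltr_pdivlMr ?mulr_gt0// mul1r -subr_gt0.
  have -> : (1 + k1) * (1 + k2) - (1 - k1) * (1 - k2) = 2 * (k1 + k2) by ring.
  by rewrite mulr_gt0.
have k0 : 0 < k by rewrite divr_gt0.
have dg : d / g = k * (1 - k1) * t0.
  by rewrite /d /g /k; field; rewrite ?n1 ?n2 ?n3 ?n4.
have k1k2 : k * (1 - k1) < 1 - k2.
  by rewrite /k mulrAC ltr_pdivrMr// ltr_pM2l//; lra.
have dgb : d / g < b.
  rewrite dg /b; apply: (@lt_le_trans _ _ ((1 - k2) * t0)); first by rewrite ltr_pM2r.
  by rewrite ler_pM2l// lerDl.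
have bd : b < d by rewrite /b /d; lra.
have d0 : 0 < d by rewrite mulr_gt0.
have [G [G1 [G2 [dG dG1 cG2 [G0 Gg] [m /andP[bm md] Gm]]]]] :=
  log_periodic_bump g b d g1 d0 dgb bd.
have kd (s : R) : is_derive s 1 (fun s => - G (k * s)) (- (k * G1 (k * s))).
  apply: is_deriveN; have d1 := is_derive_affine G _ k 0 s (dG (k * s + 0)).
  rewrite addr0 in d1.
  by rewrite (_ : (fun s => G (k * s)) = (fun s => G (k * s + 0)))//; apply/funext => y; rewrite addr0.
have kd1 (s : R) : is_derive s 1 (fun s => - (k * G1 (k * s))) (- (k * (k * G2 (k * s)))).
  apply: is_deriveN; have d1 := is_derive_affine G1 _ k 0 s (dG1 (k * s + 0)).
  rewrite addr0 in d1.
  rewrite (_ : (fun s => k * G1 (k * s)) = k *: (fun s => G1 (k * s + 0))); last first.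
    by apply/funext => y; rewrite -[in LHS](addr0 (k * y)).
  exact: (@is_deriveZ _ _ _ _ k s 1 _ d1).
exists G, G1, G2, (fun s => - G (k * s)), (fun s => - (k * G1 (k * s))),
  (fun s => - (k * (k * G2 (k * s)))); split=> //.
- split=> // s; apply: cvgN; apply: cvgM; first exact: cvg_cst.
  apply: cvgM; first exact: cvg_cst.
  apply: (@continuous_comp R R R (fun s => k * s) G2); first exact: mulrl_continuous.
  exact: cG2.
- move=> t tt; split.
    rewrite -(Gg (k * ((1 - k1) * t))); last first.
      by rewrite dg mulrA ler_wpM2l// mulr_ge0 ?ltW.
    rewrite addrC; apply/eqP; rewrite subr_eq0; apply/eqP; congr G.
    by rewrite /g /k; field; rewrite ?n1 ?n2 ?n3 ?n4.
  rewrite addrC; apply/eqP; rewrite subr_eq0; apply/eqP; congr G.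
  by rewrite /k; field; rewrite ?n1 ?n2 ?n3 ?n4.
- move=> t /andP[tt tT].
  have tb : (1 - k2) * t <= b by rewrite ler_pM2l.
  have kb : k * ((1 - k1) * t) <= b.
    apply: le_trans tb; rewrite mulrA; apply: ler_wpM2r; last exact: ltW.
    exact: le_trans (ltW t00) tt.
  have [_ ->] := G0 _ tb; have [_ ->] := G0 _ kb.
  by rewrite mulr0 oppr0.
- have [|c cbm E] := @MVT _ G G1 b m bm (fun x _ => dG x).
    exact/continuous_subspaceT/(is_derive_continuous _ _ dG).
  move: cbm; rewrite in_itv/= => /andP[bc cm].
  exists c.
    rewrite (lt_trans cm md) andbT; apply: le_lt_trans bc.
    by rewrite ler_pM2l// lerDl.
  apply: contraNneq Gm => c0; move: E; have [-> _] := G0 b (lexx _).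
  by rewrite c0 mul0r subr0 => ->.
Qed.

Section failure.
Variables l1 l2 L0 : R.
Hypotheses (hl1 : 0 <= l1 < 1) (hl2 : 0 <= l2 < 1) (hl : 0 < l1 + l2)
  (hL : 0 < L0).
Local Notation t0 := (start l1 l2 L0).

(** The profiles vanish on the incoming characteristics, and at the boundary the
    derivative of [u] is determined by the incoming one, so the traces are [0]
    while the energy is not. *)
Lemma silent_solution (T : R) (a da d2a b db d2b : R -> R) (x1 : R) :
  (forall s : R, is_derive s 1 a (da s)) -> (forall s : R, is_derive s 1 da (d2a s)) ->
  (forall s : R, is_derive s 1 b (db s)) -> (forall s : R, is_derive s 1 db (d2b s)) ->
  continuous d2a -> continuous d2b ->
  (forall t, t0 <= t -> a ((1 - l1) * t) + b ((1 + l1) * t) = 0) ->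
  (forall t, t0 <= t -> a ((1 + l2) * t) + b ((1 - l2) * t) = 0) ->
  (forall t, t0 <= t <= t0 + T -> da ((1 - l1) * t) = 0 /\ db ((1 - l2) * t) = 0) ->
  I_ l1 l2 t0 x1 -> da (t0 + x1) != 0 \/ db (t0 - x1) != 0 ->
  exists (phi0 phi1 : R -> R) (phi phix phit : R * R -> R) (tl tr : R -> R),
    [/\ H10 (I_ l1 l2 t0) phi0, L2 (I_ l1 l2 t0) phi1,
        wave_solution l1 l2 L0 phi0 phi1 phi phix phit,
        boundary_traces l1 l2 L0 phi phix phit tl tr &
        ~ (energy l1 l2 phix phit t0 <=
             obs_const l1 l2 * boundary_integral l1 l2 L0 tl tr T)].
Proof.
move=> dA d2A dB d2B ca2 cb2 bcl bcr quiet Ix1 nz.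
pose u := travelling a b.
have su : smooth_solution l1 l2 L0 u := travelling_smooth _ _ _ _ _ _ _ _ _ dA dB d2A d2B ca2 cb2 bcl bcr.
have wu := travelling_wave_solution _ _ _ hl1 hl2 hl hL _ _ _ _ _ _ dA dB d2A d2B ca2 cb2 bcl bcr.
have tu := travelling_traces _ _ _ hl1 hl2 _ _ _ _ _ _ dA dB d2A d2B ca2 cb2 bcl bcr.
have E0 := travelling_energy_gt0 _ _ _ _ _ _ _ _ _ dA dB d2A d2B x1 Ix1 nz.
have uxE : dx u = travelling da (fun s => - db s) := (travelling_dx _ _ _ _ dA dB).2.
have utE : dt u = travelling da db := (travelling_dt _ _ _ _ dA dB).2.
have [P [S [_ _ _ _ ub]]] := riemann_invariants _ _ _ hl1 hl2 hl hL u su.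
exists (slice u t0), (slice (dt u) t0), u, (dx u), (dt u),
  (fun t => dx u (- (l1 * t), t)), (fun t => dx u (l2 * t, t)).
split=> //.
- by exists (slice (dx u) t0); apply: (wave_H10 wu).
- exact: (wave_L2 wu).
have -> : boundary_integral l1 l2 L0 (fun t => dx u (- (l1 * t), t)) (fun t => dx u (l2 * t, t)) T = 0.
  rewrite /boundary_integral; under eq_Rintegral => t.
    move=> /set_mem /=; rewrite in_itv/= => tT.
    have /andP[tt _] := tT.
    have [bl br] := ub t tt; have [qa qb] := quiet t tT.
    have zl : dx u (- (l1 * t), t) = 0.
      move: bl; rewrite mulNr uxE utE /travelling /=.
      have -> : t + - (l1 * t) = (1 - l1) * t by ring.
      rewrite qa !add0r => e.
      have /andP[h1 h2] := hl1.
      have : (1 + l1) * db (t - - (l1 * t)) = 0 by rewrite mulrDl mul1r {1}e mulrN addNr.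
      by move/eqP; rewrite mulf_eq0 gt_eqF/= ?ltr_wpDr// => /eqP ->; rewrite oppr0.
    have zr : dx u (l2 * t, t) = 0.
      move: br; rewrite uxE utE /travelling /=.
      have -> : t - l2 * t = (1 - l2) * t by ring.
      rewrite qb oppr0 !addr0 => e.
      have /andP[h1 h2] := hl2.
      have : (1 + l2) * da (t + l2 * t) = 0 by rewrite mulrDl mul1r {1}e mulNr addNr.
      by move/eqP; rewrite mulf_eq0 gt_eqF/= ?ltr_wpDr// => /eqP ->.
    rewrite zl zr expr0n addr0; over.
  by rewrite /Rintegral integral0.
by rewrite mulr0 => /(lt_le_trans E0); rewrite ltxx.
Qed.

(** [T_tilde] is the larger of the times after which the two boundaries have
    seen all of the initial data. If [T] is below the one for the left boundary,
    the mirror image of the profiles is used. *)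
Lemma observability_fails (T : R) : 0 <= T < T_tilde l1 l2 L0 ->
  exists (phi0 phi1 : R -> R) (phi phix phit : R * R -> R) (tl tr : R -> R),
    [/\ H10 (I_ l1 l2 t0) phi0, L2 (I_ l1 l2 t0) phi1,
        wave_solution l1 l2 L0 phi0 phi1 phi phix phit,
        boundary_traces l1 l2 L0 phi phix phit tl tr &
        ~ (energy l1 l2 phix phit t0 <=
             obs_const l1 l2 * boundary_integral l1 l2 L0 tl tr T)].
Proof.
move=> /andP[T0]; rewrite /T_tilde lt_max.
have t00 : 0 < t0 := start_gt0 _ _ _ hl hL.
have LE : L0 = (l1 + l2) * t0 by rewrite /start mulrC divfK// gt_eqF.
have m1 : 0 < 1 - l1 by case/andP: hl1; rewrite subr_gt0.
have m2 : 0 < 1 - l2 by case/andP: hl2; rewrite subr_gt0.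
move=> /orP[]; rewrite ltr_pdivlMr// {1}LE mulrC => hT.
- rewrite [l1 + l2]addrC in hT.
  have hl' : 0 < l2 + l1 by rewrite addrC.
  have [f [df [d2f [h [dh [d2h [[F1 F2 F3] [H1 H2 H3] bc q [c /andP[c1 c2] nz]]]]]]]] :=
    silent_profile l2 l1 t0 T hl2 hl1 hl' t00 T0 hT.
  apply: (silent_solution T f df d2f h dh d2h (c - t0)) => //.
  + by move=> t /bc[_ e]; rewrite addrC.
  + by move=> t /bc[e _]; rewrite addrC.
  + by move=> t /q[].
  + by rewrite /I_ /= in_itv/=; apply/andP; split; lra.
  + by left; rewrite addrC subrK.
- have [f [df [d2f [h [dh [d2h [[F1 F2 F3] [H1 H2 H3] bc q [c /andP[c1 c2] nz]]]]]]]] :=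
    silent_profile l1 l2 t0 T hl1 hl2 hl t00 T0 hT.
  apply: (silent_solution T h dh d2h f df d2f (t0 - c)) => //.
  + by move=> t /bc[].
  + by move=> t /bc[].
  + by rewrite /I_ /= in_itv/=; apply/andP; split; lra.
  + by right; rewrite opprB addrC subrK.
Qed.

End failure.
End silent_waves.

Theorem theorem5 (R : realType) (l1 l2 : R)
    (hl1 : 0 <= l1 < 1) (hl2 : 0 <= l2 < 1) (hl : 0 < l1 + l2) :
  (forall T : R, 0 <= T ->
    exists K : R, forall L0 : R, 0 < L0 ->
      forall (phi0 phi1 : R -> R) (phi phix phit : R * R -> R) (tl tr : R -> R),
        H10 (I_ l1 l2 (start l1 l2 L0)) phi0 ->
        L2 (I_ l1 l2 (start l1 l2 L0)) phi1 ->
        wave_solution l1 l2 L0 phi0 phi1 phi phix phit ->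
        boundary_traces l1 l2 L0 phi phix phit tl tr ->
        boundary_integral l1 l2 L0 tl tr T <=
          K * energy l1 l2 phix phit (start l1 l2 L0)) /\
  (forall L0 : R, 0 < L0 ->
    (forall T : R, T_tilde l1 l2 L0 <= T ->
      observable l1 l2 L0 T /\
      forall (phi0 phi1 : R -> R) (phi phix phit : R * R -> R) (tl tr : R -> R),
        H10 (I_ l1 l2 (start l1 l2 L0)) phi0 ->
        L2 (I_ l1 l2 (start l1 l2 L0)) phi1 ->
        wave_solution l1 l2 L0 phi0 phi1 phi phix phit ->
        boundary_traces l1 l2 L0 phi phix phit tl tr ->
        energy l1 l2 phix phit (start l1 l2 L0) <=
          obs_const l1 l2 * boundary_integral l1 l2 L0 tl tr T) /\
    (forall T : R, 0 <= T < T_tilde l1 l2 L0 ->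
      exists (phi0 phi1 : R -> R) (phi phix phit : R * R -> R) (tl tr : R -> R),
        [/\ H10 (I_ l1 l2 (start l1 l2 L0)) phi0,
            L2 (I_ l1 l2 (start l1 l2 L0)) phi1,
            wave_solution l1 l2 L0 phi0 phi1 phi phix phit,
            boundary_traces l1 l2 L0 phi phix phit tl tr &
            ~ (energy l1 l2 phix phit (start l1 l2 L0) <=
                 obs_const l1 l2 * boundary_integral l1 l2 L0 tl tr T)])).
Proof.
split.
  move=> T T0; eexists => L0 hL phi0 phi1 phi phix phit tl tr _ _ _ bt.
  have [u [su cE cB]] := boundary_traces_limit _ _ _ _ _ _ _ _ _ bt T0.
  apply: ler_cvg_to cB (cvgM (cvg_cst _) cE) _; apply: nearW => n.
  exact: (smooth_direct _ _ hl1 hl2 hl _ hL _ _ (su n) T0).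
move=> L0 hL; split; last exact: observability_fails.
move=> T TT.
have T0 : 0 <= T.
  apply: le_trans TT; rewrite /T_tilde le_max; apply/orP; left.
  by case/andP: hl1 => _ ?; rewrite divr_ge0 ?subr_ge0 ?ltW.
have main (phi phix phit : R * R -> R) (tl tr : R -> R) :
    boundary_traces l1 l2 L0 phi phix phit tl tr ->
    energy l1 l2 phix phit (start l1 l2 L0) <=
      obs_const l1 l2 * boundary_integral l1 l2 L0 tl tr T.
  move=> bt; have [u [su cE cB]] := boundary_traces_limit _ _ _ _ _ _ _ _ _ bt T0.
  apply: ler_cvg_to cE (cvgM (cvg_cst _) cB) _; apply: nearW => n.
  exact: (smooth_observability _ _ hl1 hl2 hl _ hL _ _ (su n) TT).
split; last by move=> phi0 phi1 phi phix phit tl tr _ _ _; exact: main.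
exists (obs_const l1 l2); last by move=> phi0 phi1 phi phix phit tl tr _ _ _; exact: main.
have /andP[l10 l11] := hl1; have /andP[l20 l21] := hl2.
have m0 : 0 <= Num.min l1 l2 < 1 by rewrite le_min l10 l20 gt_min l11.
rewrite /obs_const; apply: divr_gt0; last first.
  by rewrite mulr_gt0// subr_gt0 gt_max l11.
rewrite mulr_gt0//; first by rewrite exprn_gt0// subr_gt0 expr_lt1//; case/andP: m0.
by rewrite lt_max /alpha divr_gt0// ?subr_gt0// ltr_wpDr.
Qed.
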